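(* Consider APE$^2$ with parameter $c>0$ and a perturbation CDF $F$ satisfying the perturbation assumption, on any $K$-armed bandit problem with $\mathbb{E}|\mathbf{R}_{t,a}|^p\le\nu_p<\infty$. Then $$\mathbb{E}[\mathcal{R}_T]=O\!\left(\sum_{a\ne a^\star}\left[\frac{C_{c,p,\nu_p,F}}{\Delta_a^{\frac{1}{p-1}}}+\frac{(6c)^{\frac{p}{p-1}}}{\Delta_a^{\frac{1}{p-1}}}\left[-F^{-1}\!\left(\frac{c^{\frac{p}{p-1}}}{T\Delta_a^{\frac{p}{p-1}}}\right)\right]_+^{\frac{p}{p-1}}+\frac{(3c)^{\frac{p}{p-1}}}{\Delta_a^{\frac{1}{p-1}}}\left[F^{-1}\!\left(1-\frac{c^{\frac{p}{p-1}}}{T\Delta_a^{\frac{p}{p-1}}}\right)\right]_+^{\frac{p}{p-1}}+\Delta_a\right]\right),$$ where $[x]_+=\max(x,0)$, $C_{c,p,\nu_p,F}>0$ is a constant depending only on $c,p,\nu_p$ and $F$ (not on $T$ or the $\Delta_a$), the hidden constant is absolute, and a term containing $F^{-1}$ is taken to be $0$ when its argument is not in $(0,1)$.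
   Context: Bandit setting: $K$ actions $\mathcal{A}$; at round $t$ the agent picks $a_t$ and observes $\mathbf{R}_{t,a_t}=r_{a_t}+\epsilon_{t,a_t}$, where $r_a\in[0,1]$, the noises $\epsilon_{t,a}$ are independent, i.i.d. over $t$, mean $0$; $p\in(1,2]$ and $\mathbb{E}|\mathbf{R}_{t,a}|^p\le\nu_p$. There is a unique optimal arm $a^\star=\arg\max_a r_a$, $\Delta_a=r_{a^\star}-r_a$, and $\mathcal{R}_T=\sum_{t=1}^T(r_{a^\star}-r_{a_t})$. $n_{t,a}$ = number of pulls of $a$ in rounds $1..t$. $b_p:=\left[2\left(\frac{2-p}{p-1}\right)^{1-\frac{2}{p}}+\left(\frac{2-p}{p-1}\right)^{2-\frac{2}{p}}\right]^{-p/2}$ (with $0^0=1$), $\psi_p(x):=\ln(b_p|x|^p+x+1)$ for $x\ge0$, $\psi_p(x):=-\ln(b_p|x|^p-x+1)$ for $x<0$. APE$^2$ with parameter $c>0$ and perturbation CDF $F$: in rounds $1,\dots,K$ each arm is pulled once. For $t>K$ and each $a$, with $n=n_{t-1,a}$, set $\hat r_{t-1,a}:=\frac{c}{n^{1-1/p}}\sum_{k\le t-1:\,a_k=a}\psi_p\!\left(\frac{\mathbf{R}_{k,a}}{c\,n^{1/p}}\right)$ and $\beta_{t-1,a}:=c/n^{1-1/p}$; draw $G_{t,a}\sim F$ independently of everything else, and choose $a_t=\arg\max_a\{\hat r_{t-1,a}+\beta_{t-1,a}G_{t,a}\}$. Perturbation assumption: $F(g)=\mathbb{P}(G<g)$ is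 a continuous, differentiable CDF with unbounded support; $F$ is log-concave; $F(0)\le1/2$; and with hazard rate $h(x):=\frac{d}{dx}\ln\frac{1}{1-F(x)}$ there is $C_F<\infty$ with $\int_0^\infty\frac{h(x)e^{-x}}{1-F(x)}dx\le C_F$. $F^{-1}(y):=\inf\{x:F(x)\ge y\}$ for $y\in(0,1)$. *)

(* Defs.v *)
From HB Require Import structures.
From mathcomp Require Import all_boot all_order all_algebra.
From mathcomp Require Import all_classical all_reals all_analysis.
Set Implicit Arguments. Unset Strict Implicit. Unset Printing Implicit Defensive.
Import Order.TTheory GRing.Theory Num.Theory.
Import numFieldNormedType.Exports.
Local Open Scope classical_set_scope.
Local Open Scope ring_scope.

Section APE2.
Variable R : realType.

Definition posp (x : R) : R := Num.max x 0.

(* b_p, with 0^0 = 1 (powR 0 0 = 1 in MathComp-Analysis) *)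
Definition b_p (p : R) : R :=
  let z := (2 - p) / (p - 1) in
  (2 * z `^ (1 - 2 / p) + z `^ (2 - 2 / p)) `^ (- (p / 2)).

Definition psi_p (p x : R) : R :=
  if 0 <= x then ln (b_p p * `|x| `^ p + x + 1)
  else - ln (b_p p * `|x| `^ p - x + 1).

Definition Finv (F : R -> R) (y : R) : R := inf [set x : R | y <= F x].

Definition Finv0 (F : R -> R) (y : R) : R := if (0 < y < 1) then Finv F y else 0.

Definition log_concave (F : R -> R) : Prop :=
  forall x y l : R, 0 < l < 1 ->
    F x `^ l * F y `^ (1 - l) <= F (l * x + (1 - l) * y).

Definition hazard (F : R -> R) (x : R) : R :=
  derive1 (fun z => ln ((1 - F z)^-1)) x.

(* Perturbation assumption on the CDF F(g) = P(G < g). *)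
Definition perturbation_assumption (F : R -> R) : Prop :=
  {homo F : x y / x <= y} /\
  F x @[x --> -oo] --> (0:R) /\
  F x @[x --> +oo] --> (1:R) /\
  continuous F /\
  (forall x, derivable F x 1) /\
  (forall x, F x < 1) /\
  log_concave F /\
  F 0 <= 2^-1 /\
  exists CF : R,
        (\int[@lebesgue_measure R]_(x in [set x : R | (0 <= x)%R])
            ((hazard F x * expR (- x) / (1 - F x))%R%:E) <= CF%:E)%E.

Variable A : finType.

Definition pulls (h : seq A) (a : A) : nat := count_mem a h.

(* estimator \hat r_{t-1,a}; rw k a = observed reward R_{k,a} at round k *)
Definition ape2_est (c p : R) (rw : nat -> A -> R) (h : seq A) (a : A) : R :=
  let n : R := (pulls h a)%:R in
  c / n `^ (1 - p^-1) *
    \sum_(k < size h | nth a h k == a) psi_p p (rw k.+1 a / (c * n `^ (p^-1))).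

Definition ape2_beta (c p : R) (h : seq A) (a : A) : R :=
  c / ((pulls h a)%:R) `^ (1 - p^-1).

(* action at round t (t >= 1), given the history h of rounds 1..t-1 and
   perturbations g t a = G_{t,a}; a0 only serves as default/tie-breaking *)
Definition ape2_choose (a0 : A) (c p : R) (rw g : nat -> A -> R)
    (t : nat) (h : seq A) : A :=
  if (t <= #|A|)%N then nth a0 (enum A) t.-1
  else [arg max_(a > a0) (ape2_est c p rw h a + ape2_beta c p h a * g t a)]%O.

Fixpoint ape2_hist (a0 : A) (c p : R) (rw g : nat -> A -> R) (t : nat) : seq A :=
  match t with
  | 0 => [::]
  | t'.+1 => let h := ape2_hist a0 c p rw g t' in
             rcons h (ape2_choose a0 c p rw g t'.+1 h)
  end.

Definition ape2_action (a0 : A) (c p : R) (rw g : nat -> A -> R) (t : nat) : A :=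
  last a0 (ape2_hist a0 c p rw g t).

End APE2.

Definition mutually_independent {R : realType} {d} {Omega : measurableType d}
    (P : probability Omega R) {I : eqType} (D : pred I) (X : I -> Omega -> R) : Prop :=
  forall (J : seq I) (B : I -> set R),
    uniq J -> all D J -> (forall i, measurable (B i)) ->
    fine (P (\big[setI/setT]_(i <- J) (X i @^-1` B i))) =
    \prod_(i <- J) fine (P (X i @^-1` B i)).

(* Main.v *)
(* Let [D_n = Delta_a / (3 beta_n)] and [M = b_p nu / c^p]. The bounds
   [- ln (1 - x + b_p |x|^p) <= psi_p x <= ln (1 + x + b_p |x|^p)] make
   [exp (+- (estimator - mean) / beta_n)] essentially a supermartingale in the
   number of pulls, so the estimation error after [n] pulls, divided by [beta_n],
   exceeds [x] with probability at most [e^(M - x)].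

   A pull of a suboptimal arm [a] outside the first round-robin phase falls in one
   of four cases: [a] has few pulls; [G_{t,a}] is large; the estimate of [a] is too
   large; or all indices, that of [a*] included, lie below [y = r_a* - Delta_a / 3].
   The last case is compared with pulls of [a*]. With [z = (y - estimate) / beta_n],
   given the history and the other perturbations the index of [a*] is at most [y]
   with probability [F z], and otherwise [a*] is pulled. Hence the expected number
   of such rounds at [n] pulls of [a*] is bounded by the mean of the odds
   [F / (1 - F)] at [z], which the exponential tail of [z + D_n] and the hazard rate
   condition bound by [2 F (- D_n / 2) + O (e^(M - D_n / 2))]. Here [z] is
   discretised, so that only the independence of events is needed. *)
Require Import Defs.
From HB Require Import structures.
From mathcomp Require Import all_boot all_order all_algebra.
From mathcomp Require Import all_classical all_reals all_analysis.
From mathcomp Require Import measurable_realfun ring lra.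
Import Order.TTheory GRing.Theory Num.Theory.
Import numFieldNormedType.Exports.
Local Open Scope classical_set_scope.
Local Open Scope ring_scope.
Set Implicit Arguments. Unset Strict Implicit. Unset Printing Implicit Defensive.

(** * The influence function and a series bound *)

(** Sampling is adaptive and the argument of [psi_p] is rescaled at each pull, so the estimate after
    [n] pulls is no sum of independent terms, and a union bound over rounds would cost a factor [T].
    For each [n] a separate exponential process with fixed scale [c n^(1/p)] is followed through all
    rounds and truncated after [n] pulls; the mass lost by truncation sums over the rounds to at
    most 1. With this scale [n] pulls accumulate the excess [b_p nu / c^p = M], whatever [n].

    The value [z] sits near [- D_n]. Cutting at half that distance makes both sides small: below the
    cut the odds are at most those at [- D_n / 2], above it the tail is [e^(M - D_n / 2)]. This
    halving is why the first quantile term has [6 c] and the second [3 c].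

    Log-concavity makes [F'] continuous where [F > 0]. The increments of the odds are then integrals
    of [F' / (1 - F)^2], which is the hazard integrand without its weight [e^(-x)]; summation by
    parts meets these increments weighted by the exponential tail of [z]. *)

Lemma powRD_gt0 (R : realType) (x r s : R) : 0 < x ->
  x `^ (r + s) = x `^ r * x `^ s.
Proof. by move=> x0; rewrite powRD// (gt_eqF x0) implybT. Qed.

(** Weighted AM-GM of [1] and [v]: once [v^s] is factored out, the first-order terms of two bounds
    [exp u >= 1 + u] cancel in the convex combination. *)
Lemma powR_le_affine (R : realType) (s v : R) : 0 <= s <= 1 -> 0 < v ->
  v `^ s <= 1 - s + s * v.
Proof.
move=> /andP[s0 s1] v0; set L := ln v.
have vE : v = v `^ s * expR ((1 - s) * L).
  by rewrite /powR gt_eqF// -/L -expRD -mulrDl addrC subrK mul1r lnK.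
have oneE : 1 = v `^ s * expR (- (s * L)).
  by rewrite /powR gt_eqF// -/L -expRD subrr expR0.
have e1 := expR_ge1Dx ((1 - s) * L).
have e2 := expR_ge1Dx (- (s * L)).
have w0 : 0 <= v `^ s by exact: powR_ge0.
have -> : 1 - s + s * v =
    v `^ s * ((1 - s) * expR (- (s * L)) + s * expR ((1 - s) * L)).
  by rewrite mulrDr mulrCA -oneE mulr1 mulrCA -vE.
rewrite -[leLHS]mulr1; apply: ler_wpM2l => //.
have e3 : 1 = (1 - s) * (1 + - (s * L)) + s * (1 + (1 - s) * L) by ring.
rewrite [leLHS]e3.
by apply: lerD; apply: ler_wpM2l => //; rewrite subr_ge0.
Qed.

(* [z] is the minimiser of [u |-> 2 u^(1-e) + u^(2-e)], where [e = 2 / p]. *)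
Lemma b_p_minimum (R : realType) (e z u : R) : 1 <= e < 2 ->
  z = 2 * (e - 1) / (2 - e) -> 0 < u ->
  2 * z `^ (1 - e) + z `^ (2 - e) <= 2 * u `^ (1 - e) + u `^ (2 - e).
Proof.
move=> /andP[e1 e2] zE u0.
(* This is [p = 2]: [z = 0], and the value 2 is an infimum approached as [u] tends to 0, thanks to
   [0^0 = 1]. *)
have [e1E|e1n] := eqVneq e 1.
  rewrite zE e1E subrr mulr0 mul0r !powRr0 powR0 ?addr0; last by lra.
  by rewrite lerDl powR_ge0.
have e1' : 1 < e by rewrite lt_def e1n.
have z0 : 0 < z by rewrite zE divr_gt0//; lra.
set v := u / z; have v0 : 0 < v by rewrite divr_gt0.
have uE : u = z * v by rewrite /v mulrC divfK// gt_eqF.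
(* With [u = z v] the claim reduces to [(2 + z) v^(e-1) <= 2 + z v]. The right side is [2 + z] times
   the tangent of the concave power at [v = 1], precisely for this [z]. *)
have yv := @powR_le_affine _ (e - 1) v ltac:(lra) v0.
have v2E (x : R) (x0 : 0 < x) : x `^ (2 - e) = x * x `^ (1 - e).
  have -> : 2 - e = 1 + (1 - e) by ring.
  by rewrite powRD_gt0// powRr1// ltW.
have vV : v `^ (1 - e) * v `^ (e - 1) = 1.
  by rewrite -powRD_gt0// addrA subrK subrr powRr0.
have [z0' v0'] := (ltW z0, ltW v0).
rewrite !v2E// [u in leRHS]uE powRM// -!mulrDl.
rewrite [leRHS]mulrCA [leLHS]mulrC; apply: ler_wpM2l; first exact: powR_ge0.
have -> : 2 + z = (2 + z) * v `^ (e - 1) * v `^ (1 - e).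
  by rewrite -mulrA [X in _ * X]mulrC vV mulr1.
apply: ler_wpM2r; first exact: powR_ge0.
have z2 : 2 + z = 2 / (2 - e) by rewrite zE; field; lra.
apply: le_trans (_ : (2 + z) * (1 - (e - 1) + (e - 1) * v) <= _).
  by apply: ler_wpM2l => //; lra.
have -> : (2 + z) * (1 - (e - 1) + (e - 1) * v) = 2 + z * v; last by [].
by rewrite z2 zE; field; lra.
Qed.

Lemma b_p_gt0 (R : realType) (p : R) : 1 < p <= 2 -> 0 < b_p p.
Proof.
move=> /andP[p1 p2]; rewrite /b_p; apply: powR_gt0.
have [->|p2'] := eqVneq p 2.
  rewrite subrr mul0r divff// subrr powRr0.
  by rewrite ltr_wpDr ?powR_ge0//; lra.
have z0 : 0 < (2 - p) / (p - 1).
  by rewrite divr_gt0// subr_gt0// lt_def eq_sym p2'.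
by rewrite ltr_wpDr ?powR_ge0// mulr_gt0// powR_gt0.
Qed.

(** The origin of [b_p]: with [u = b_p x^p] and [e = 2 / p] one has [x^2 = u^e K], where
    [K = b_p^(-e)] is the lower bound of [b_p_minimum]. Dividing the claim by [u^e] leaves
    [K <= 2 u^(1-e) + u^(2-e)]. *)
Lemma sqr_le_b_p (R : realType) (p x : R) : 1 < p <= 2 -> 0 <= x ->
  x ^+ 2 <= 2 * (b_p p * x `^ p) + (b_p p * x `^ p) ^+ 2.
Proof.
move=> p12; have b0 := b_p_gt0 p12; have /andP[p1 p2] := p12.
rewrite le_eqVlt => /predU1P[<-|x0].
  rewrite expr0n/=; apply: addr_ge0 (sqr_ge0 _).
  by apply: mulr_ge0 => //; apply: mulr_ge0; [exact: ltW|exact: powR_ge0].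
set u := b_p p * x `^ p.
have u0 : 0 < u by rewrite mulr_gt0// powR_gt0.
have pn0 : p != 0 by rewrite gt_eqF//; lra.
set e := 2 / p; have ep : e * p = 2 by rewrite divfK.
have e12 : 1 <= e < 2.
  by rewrite /e; apply/andP; split; [rewrite ler_pdivlMr|rewrite ltr_pdivrMr]; lra.
set z := (2 - p) / (p - 1).
have zE : z = 2 * (e - 1) / (2 - e).
  rewrite /z /e; field.
  by apply/and3P; split; lra.
have min := b_p_minimum e12 zE u0.
set K := 2 * z `^ (1 - e) + z `^ (2 - e) in min.
have K0 : 0 < K.
  rewrite lt_def; apply/andP; split; last first.
    by rewrite addr_ge0 ?powR_ge0// mulr_ge0// powR_ge0.
  apply/eqP => K0; have : b_p p = K `^ (- (p / 2)) by [].
  rewrite K0 powR0 => [b00|]; first by rewrite b00 ltxx in b0.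
  by rewrite oppr_eq0 mulf_neq0.
have xE : x ^+ 2 = u `^ e * K.
  rewrite /u powRM ?powR_ge0 ?ltW// -powRrM [p * e]mulrC ep.
  have -> : b_p p `^ e = K^-1.
    rewrite -[LHS]/((K `^ (- (p / 2))) `^ e) -powRrM.
    have -> : - (p / 2) * e = -1 by rewrite /e; field.
    by rewrite powR_inv1// ltW.
  by rewrite mulrAC mulVf ?mul1r ?gt_eqF// -powR_mulrn// ltW.
rewrite xE; apply: le_trans (_ : u `^ e * (2 * u `^ (1 - e) + u `^ (2 - e)) <= _).
  by apply: ler_wpM2l => //; exact: powR_ge0.
rewrite mulrDr mulrCA -!powRD_gt0//.
have -> : e + (1 - e) = 1 by ring.
have -> : e + (2 - e) = 2%:R by ring.
have u0' := ltW u0.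
by rewrite powRr1// powR_mulrn.
Qed.

(** [psi_p] is odd, so take [x >= 0]. The first bound is then an equality; the second says
    [(1 + u)^2 - x^2 >= 1] with [u = b_p x^p], which is [sqr_le_b_p]. *)
Lemma psi_p_bounds (R : realType) (p x : R) : 1 < p <= 2 ->
  expR (psi_p p x) <= 1 + x + b_p p * `|x| `^ p /\
  expR (- psi_p p x) <= 1 - x + b_p p * `|x| `^ p.
Proof.
move=> p12.
wlog x0 : x / 0 <= x => [H|].
  have [x0|x0] := leP 0 x; first exact: H.
  have /H[] : 0 <= - x by rewrite oppr_ge0 ltW.
  have -> : psi_p p (- x) = - psi_p p x.
    by rewrite /psi_p oppr_ge0 (ltW x0) leNgt x0/= normrN opprK.
  by rewrite normrN !opprK.
have b0 := b_p_gt0 p12.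
have sq := sqr_le_b_p p12 x0.
rewrite /psi_p x0 ger0_norm//; set u := b_p p * x `^ p in sq *.
have u0 : 0 <= u by rewrite mulr_ge0 ?powR_ge0// ltW.
have y0 : 0 < u + x + 1 by lra.
have y1 : 0 < 1 - x + u.
  rewrite ltNge; apply/negP => h.
  have : (1 + u) ^+ 2 <= x ^+ 2 by rewrite ler_sqr ?nnegrE; lra.
  by rewrite sqrrD; lra.
rewrite expRN lnK ?posrE//; split; first by lra.
rewrite -[leLHS]mul1r ler_pdivrMr//.
have -> : (1 - x + u) * (u + x + 1) = 1 + (2 * u + u ^+ 2 - x ^+ 2) by ring.
by rewrite lerDl subr_ge0.
Qed.

Lemma measurable_psi_p (R : realType) (p : R) : measurable_fun setT (psi_p p).
Proof.
have mb : measurable_fun setT (fun x : R => b_p p * `|x| `^ p).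
  apply: measurable_funM => //.
  apply: (measurableT_comp (measurable_powR p)); exact: normr_measurable.
apply: measurable_fun_ifT => /=.
- exact: measurable_fun_ler.
- apply: measurableT_comp => //.
  by apply: measurable_funD => //; apply: measurable_funD.
- apply: measurableT_comp => //; apply: measurableT_comp => //.
  by apply: measurable_funD => //; apply: measurable_funB.
Qed.

(** The point is linearity in [n0]. Raising [t <= e^t] at [t = x / (2 q)] to the power [q] gives
    [x^q <= (2 q)^q e^(x/2)], so the summand is at most a constant over [(1 + n / n0)^2]. *)
Lemma sum_exp_root_le (R : realType) (q n0 : R) (T : nat) : 0 < q -> 0 < n0 ->
  \sum_(1 <= n < T) expR (- (n%:R / n0) `^ q^-1) <=
  (1 + (2 * q) `^ q) ^+ 2 * n0.
Proof.
move=> q0 n00.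
have exp_bound (y : R) : 0 <= y ->
    expR (- y `^ q^-1) <= (1 + (2 * q) `^ q) ^+ 2 / (1 + y) ^+ 2.
  move=> y0; set x := y `^ q^-1.
  have x0 : 0 <= x by exact: powR_ge0.
  have yE : y = x `^ q by rewrite /x -powRrM mulVf ?gt_eqF// powRr1.
  set Q := (2 * q) `^ q; have Q0 : 0 <= Q by exact: powR_ge0.
  have yQ : y <= Q * expR (x / 2).
    have -> : x / 2 = x / (2 * q) * q by field; lra.
    rewrite expRM /Q -powRM ?expR_ge0//; last by lra.
    rewrite yE; apply: ge0_ler_powR; rewrite ?nnegrE//; first exact: ltW.
      by rewrite mulr_ge0 ?expR_ge0//; lra.
    rewrite -ler_pdivrMl; last by lra.
    rewrite mulrC; apply: le_trans (expR_ge1Dx _); lra.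
  have e1 : 1 <= expR (x / 2) by rewrite -expR0 ler_expR divr_ge0.
  have y1Q : 1 + y <= (1 + Q) * expR (x / 2) by lra.
  rewrite ler_pdivlMr; last by rewrite exprn_gt0//; lra.
  have -> : (1 + Q) ^+ 2 = expR (- x) * ((1 + Q) * expR (x / 2)) ^+ 2.
    rewrite exprMn -expRM_natl mulrCA -expRD.
    have -> : - x + 2%:R * (x / 2) = 0 by field.
    by rewrite expR0 mulr1.
  apply: ler_wpM2l; first exact: expR_ge0.
  by rewrite ler_sqr ?nnegrE; lra.
set C := _ ^+ 2; have C0 : 0 <= C by exact: sqr_ge0.
(* the bound telescopes since 1/(n0+n)^2 <= 1/(n0+n-1) - 1/(n0+n) *)
suff H : \sum_(1 <= n < T.+1) expR (- (n%:R / n0) `^ q^-1) <=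
    C * n0 ^+ 2 * (n0^-1 - (n0 + T%:R)^-1).
  case: T H => [|T] H.
    by rewrite big_geq//; apply: mulr_ge0 => //; exact: ltW.
  have : 0 <= expR (- (T.+1%:R / n0) `^ q^-1) by exact: expR_ge0.
  rewrite big_nat_recr//= in H => e0.
  apply: le_trans (_ : C * n0 ^+ 2 * (n0^-1 - (n0 + T.+1%:R)^-1) <= _); first by lra.
  have -> : C * n0 = C * n0 ^+ 2 * n0^-1 by field; rewrite gt_eqF.
  apply: ler_wpM2l; first by rewrite mulr_ge0// sqr_ge0.
  by rewrite gerBl invr_ge0 addr_ge0// ltW.
elim: T => [|T IH]; first by rewrite big_geq// addr0 subrr mulr0.
rewrite big_nat_recr//=.
set t : R := T%:R; have t0 : 0 <= t by rewrite /t.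
have tE : T.+1%:R = t + 1 by rewrite -natr1.
have Tn0 : 0 <= T.+1%:R / n0 by apply: divr_ge0 => //; exact: ltW.
have := exp_bound _ Tn0; rewrite -/C tE => eb.
apply: le_trans (lerD IH eb) _; rewrite -/t.
have -> : C / (1 + (t + 1) / n0) ^+ 2 = C * n0 ^+ 2 * ((n0 + (t + 1)) ^+ 2)^-1.
  by field; rewrite !gt_eqF//; lra.
rewrite -mulrDr; apply: ler_wpM2l; first by rewrite mulr_ge0// sqr_ge0.
set a := n0 + t; have a0 : 0 < a by rewrite /a; lra.
rewrite addrA -/a.
suff : ((a + 1) ^+ 2)^-1 <= a^-1 - (a + 1)^-1 by lra.
have -> : a^-1 - (a + 1)^-1 = (a * (a + 1))^-1 by field; rewrite !gt_eqF//; lra.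
rewrite lef_pV2 ?posrE ?mulr_gt0 ?exprn_gt0//; lra.
Qed.

(** * Derivatives of concave functions *)

Lemma derive_quotient_cvg (R : realType) (f : R -> R) (x : R) :
  derivable f x 1 -> (fun h => (f (x + h) - f x) / h) @ 0^' --> derive1 f x.
Proof.
move=> df; rewrite derive1E.
have -> : (fun h => (f (x + h) - f x) / h) =
    (fun h => h^-1 *: (f (h *: (1:R) + x) - f x)).
  by apply/funext => h; rewrite /GRing.scale/= mulr1 mulrC [h + x]addrC.
exact: df.
Qed.

Lemma derive_quotient_cvgr (R : realType) (f : R -> R) (x : R) :
  derivable f x 1 -> (fun h => (f (x + h) - f x) / h) @ 0^'+ --> derive1 f x.
Proof.
move=> /derive_quotient_cvg; apply: cvg_trans; apply: cvg_app.
by apply: within_subset => y /= y0; rewrite gt_eqF.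
Qed.

Lemma derive_quotient_cvgl (R : realType) (f : R -> R) (x : R) :
  derivable f x 1 -> (fun h => (f x - f (x - h)) / h) @ 0^'+ --> derive1 f x.
Proof.
move=> /derive_quotient_cvg df.
have -> : (fun h => (f x - f (x - h)) / h) =
    (fun h => (f (x + h) - f x) / h) \o -%R.
  by apply/funext => h /=; rewrite -mulrNN invrN opprB.
rewrite -[X in X^'+]oppr0; apply/cvg_at_leftNP.
apply: cvg_trans df; apply: cvg_app.
by apply: within_subset => y /= y0; rewrite lt_eqF.
Qed.

(** A pointwise limit of difference quotients with steps [1 / (n + 1)]; no continuity of the
    derivative is assumed. *)
Lemma measurable_derive1 (R : realType) (f : R -> R) :
  (forall x, derivable f x 1) -> measurable_fun setT (derive1 f).
Proof.
move=> df.
have cf : continuous f.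
  by move=> x; apply: differentiable_continuous; exact/derivable1_diffP.
refine (@measurable_fun_cvg _ _ R setT
  (fun (n : nat) (x : R) => (f (x + harmonic n) - f x) / harmonic n) _ _ _).
- move=> n; apply: measurable_funM => //; apply: measurable_funB.
    apply: (measurableT_comp (continuous_measurable_fun cf)).
    exact: measurable_funD.
  exact: continuous_measurable_fun.
- move=> x _.
  have h0 : harmonic @ \oo --> (0 : R)^'+.
    move=> A /= [e e0 eA]; have /cvgrPdist_lt /(_ e e0) := @cvg_harmonic R.
    by apply: filterS => n /= he; apply: eA => //=; rewrite invr_gt0 ltr0n.
  exact: (cvg_comp _ _ h0 (derive_quotient_cvgr (df x))).
Qed.

Lemma derive1_ge0_ndecr (R : realType) (f : R -> R) (x : R) :
  {homo f : x y / x <= y} -> derivable f x 1 -> 0 <= derive1 f x.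
Proof.
move=> hf /derive_quotient_cvgr /cvgr_to_ge; apply.
near=> h; have h0 : 0 < h by [].
by rewrite divr_ge0 ?subr_ge0 ?hf ?lerDl ?(ltW h0).
Unshelve. all: by end_near. Qed.

Section concave.
Variables (R : realType) (g : R -> R) (a : R).
Hypothesis cg : forall u v w : R, a < u -> u < w -> w < v ->
  (v - w) * g u + (w - u) * g v <= (v - u) * g w.
Hypothesis dg : forall u : R, a < u -> derivable g u 1.

Lemma concave_derive_ge (u v : R) : a < u -> u < v ->
  (g v - g u) / (v - u) <= derive1 g u.
Proof.
move=> au uv; apply: (cvgr_to_ge (derive_quotient_cvgr (dg au))).
near=> h.
have h0 : 0 < h by [].
have hv : h < v - u by near: h; apply: nbhs_right_lt; rewrite subr_gt0.
have uv0 : 0 < v - u by rewrite subr_gt0.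
rewrite ler_pdivlMr// mulrAC ler_pdivrMr//.
have := @cg u v (u + h) au ltac:(lra) ltac:(lra).
by lra.
Unshelve. all: by end_near. Qed.

Lemma concave_derive_le (u v : R) : a < u -> u < v ->
  derive1 g v <= (g v - g u) / (v - u).
Proof.
move=> au uv; have av := lt_trans au uv.
apply: (cvgr_to_le (derive_quotient_cvgl (dg av))).
near=> h.
have h0 : 0 < h by [].
have hv : h < v - u by near: h; apply: nbhs_right_lt; rewrite subr_gt0.
have uv0 : 0 < v - u by rewrite subr_gt0.
rewrite ler_pdivlMr// mulrAC ler_pdivrMr//.
have := @cg u v (v - h) au ltac:(lra) ltac:(lra).
by lra.
Unshelve. all: by end_near. Qed.

(** The slopes over [[y, y + d]] and [[y - d, y]] enclose the derivative at [y]. For fixed [d] they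
    are continuous in [y], and for small [d] both are close to the derivative at [x]. *)
Lemma concave_derive_continuous (x : R) : a < x ->
  {for x, continuous (derive1 g)}.
Proof.
move=> ax; apply/cvgrPdist_lt => e e0.
have cgu (u : R) : a < u -> {for u, continuous g}.
  by move=> au; apply: differentiable_continuous; exact/derivable1_diffP/dg.
have e20 : 0 < e / 2 by rewrite divr_gt0.
have /cvgrPdist_lt/(_ _ e20) qr := derive_quotient_cvgr (dg ax).
have /cvgrPdist_lt/(_ _ e20) ql := derive_quotient_cvgl (dg ax).
have [d [d0 [dx dr dl]]] : exists d, 0 < d /\
   [/\ d < x - a, `|derive1 g x - (g (x + d) - g x) / d| < e / 2 &
     `|derive1 g x - (g x - g (x - d)) / d| < e / 2].
  near (0:R)^'+ => d; exists d; split; [by []|split].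
  - by near: d; apply: nbhs_right_lt; rewrite subr_gt0.
  - by near: d.
  - by near: d.
have shift_cont (s : R) : a < x + s ->
    (fun y => g (y + s)) @ x --> g (x + s).
  move=> axs; apply: (@continuous_comp _ _ _ (fun y => y + s) g).
    by apply: cvgD => //; exact: cvg_cst.
  exact: cgu.
have c1 : (fun y => (g (y + d) - g y) / d) @ x --> (g (x + d) - g x) / d.
  by apply: cvgMl; apply: cvgB; [apply: shift_cont; lra|exact: cgu].
have c2 : (fun y => (g y - g (y - d)) / d) @ x --> (g x - g (x - d)) / d.
  by apply: cvgMl; apply: cvgB; [exact: cgu|apply: shift_cont; lra].
move/cvgrPdist_lt/(_ _ e20) : c1 => c1; move/cvgrPdist_lt/(_ _ e20) : c2 => c2.
near=> y.
have ay : a + d < y.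
  by near: y; apply: lt_nbhsr; lra.
have ay' : a < y by lra.
have := @concave_derive_ge y (y + d) ay' ltac:(lra).
have := @concave_derive_le (y - d) y ltac:(lra) ltac:(lra).
have -> : y + d - y = d by ring.
have -> : y - (y - d) = d by ring.
have y1 : `|(g (x + d) - g x) / d - (g (y + d) - g y) / d| < e / 2 by near: y.
have y2 : `|(g x - g (x - d)) / d - (g y - g (y - d)) / d| < e / 2 by near: y.
move: (dr) (dl) (y1) (y2); rewrite !ltr_norml.
by move=> /andP[? ?] /andP[? ?] /andP[? ?] /andP[? ?] ? ?; apply/andP; split; lra.
Unshelve. all: by end_near. Qed.

End concave.

(** * The perturbation distribution *)

(** The mean number of failures before the first success, when each trial fails with probability
    [F x]. *)
Definition odds (R : realType) (F : R -> R) (x : R) : R := F x / (1 - F x).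

Section perturbation.
Variables (R : realType) (F : R -> R).
Hypothesis PF : perturbation_assumption F.

Let homoF : {homo F : x y / x <= y}. Proof. by case: PF. Qed.
Let F_Ny : F x @[x --> -oo] --> (0:R). Proof. by case: PF => [_ []]. Qed.
Let F_y : F x @[x --> +oo] --> (1:R). Proof. by case: PF => [_ [_ []]]. Qed.
Let contF : continuous F. Proof. by case: PF => [_ [_ [_ []]]]. Qed.
Let dF x : derivable F x 1. Proof. by case: PF => [_ [_ [_ [_ []]]]]. Qed.
Let F_lt1 x : F x < 1. Proof. by case: PF => [_ [_ [_ [_ [_ []]]]]]. Qed.
Let lcF : log_concave F. Proof. by case: PF => [_ [_ [_ [_ [_ [_ []]]]]]]. Qed.
Let F0 : F 0 <= 2^-1. Proof. by case: PF => [_ [_ [_ [_ [_ [_ [_ []]]]]]]]. Qed.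

Let isF (x : R) : is_derive x 1 F (derive1 F x).
Proof. by rewrite derive1E; apply: DeriveDef. Qed.

Lemma cdf_ge0 x : 0 <= F x.
Proof.
apply: (cvgr_to_le F_Ny); near=> y; apply: homoF; near: y.
by apply: nbhs_ninfty_le; exact: num_real.
Unshelve. all: by end_near. Qed.

Lemma odds_le x y : x <= y -> odds F x <= odds F y.
Proof.
move=> xy; rewrite /odds; have h := homoF xy.
apply: ler_pM => //; first exact: cdf_ge0.
  by rewrite invr_ge0 subr_ge0 ltW.
by rewrite lef_pV2 ?posrE ?subr_gt0// lerD2l lerN2.
Qed.

Lemma odds_ge0 x : 0 <= odds F x.
Proof. by rewrite /odds divr_ge0 ?cdf_ge0// subr_ge0 ltW. Qed.

Lemma odds_le_double x : x <= 0 -> odds F x <= 2 * F x.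
Proof.
move=> /homoF Fx; rewrite /odds ler_pdivrMr ?subr_gt0//.
have := cdf_ge0 x => ?; have : F x * F x <= F x * 2^-1.
  by apply: ler_wpM2l => //; apply: le_trans Fx F0.
lra.
Qed.

Lemma odds0_le1 : odds F 0 <= 1.
Proof. by apply: le_trans (odds_le_double (lexx _)) _; have := F0; lra. Qed.

Let isSF (x : R) : is_derive x 1 (fun z => 1 - F z) (- derive1 F x).
Proof.
have h := is_deriveB (is_derive_cst (1 : R) x (1 : R)) (isF x).
by apply: (is_derive_eq h); rewrite sub0r.
Qed.

Lemma hazardE x : hazard F x = derive1 F x / (1 - F x).
Proof.
rewrite /hazard.
have -> : (fun z => ln (1 - F z)^-1) = (fun z => - (@ln R \o (fun z => 1 - F z)) z).
  by apply/funext => z /=; rewrite lnV// posrE subr_gt0.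
have Sx : 0 < 1 - F x by rewrite subr_gt0.
have h := @is_derive1_comp _ _ (fun z => 1 - F z) _ _ _ (is_derive1_ln Sx) (isSF x).
have h' := is_deriveN h.
by rewrite derive1E (@derive_val _ _ _ _ _ _ _ h') mulrN opprK mulrC.
Qed.

(** By [hazardE] this derivative equals [hazard F x / (1 - F x)]: the hazard condition bounds the
    integral of the odds' derivative against [e^(-x)]. *)
Lemma is_derive_odds (x : R) :
  is_derive x 1 (odds F) (derive1 F x / (1 - F x) ^+ 2).
Proof.
have Sx : 1 - F x != 0 by rewrite gt_eqF// subr_gt0.
have -> : odds F = (fun z => (1 - F z)^-1 - 1).
  apply/funext => z; rewrite /odds.
  by field; rewrite gt_eqF// subr_gt0.
have h := @is_deriveV _ (fun z => 1 - F z) _ _ _ Sx (isSF x).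
have h' := is_deriveB h (is_derive_cst (1 : R) x (1 : R)).
apply: (is_derive_eq h').
by rewrite subr0 /GRing.scale/= mulrN mulNr opprK mulrC.
Qed.

(* [ln F] is concave, so its derivative is monotone, hence continuous. *)
Lemma derive1_cdf_continuous x : 0 < F x -> {for x, continuous (derive1 F)}.
Proof.
move=> Fx.
(* [F] may vanish far to the left, so [ln F] is used only on a half-line around [x] on which [F] is
   positive. *)
have [a [ax Fa]] : exists a, a < x /\ 0 < F a.
  have /cvgrPdist_lt/(_ _ Fx)/nbhs_ballP[e /= e0 eF] : F y @[y --> x] --> F x by exact: contF.
  exists (x - e / 2); split; first by rewrite ltrBlDr ltrDl divr_gt0.
  have := eF (x - e / 2); rewrite /ball/= opprB addrC subrK.
  rewrite ger0_norm ?divr_ge0// ?(ltW e0)// => /(_ ltac:(lra)).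
  by rewrite ltr_norml => /andP[]; lra.
have F_gt0 y : a < y -> 0 < F y.
  by move=> ay; apply: lt_le_trans Fa _; exact/homoF/ltW.
pose g := @ln R \o F.
have isg y : a < y -> is_derive y 1 g ((F y)^-1 * derive1 F y).
  by move=> ay; apply: is_derive1_comp (is_derive1_ln (F_gt0 _ ay)) (isF y).
have dg y : a < y -> derivable g y 1 by move=> /isg[].
have cg (u v w : R) : a < u -> u < w -> w < v ->
    (v - w) * g u + (w - u) * g v <= (v - u) * g w.
  move=> au uw wv; have [aw av] : a < w /\ a < v by split; lra.
  have uv0 : 0 < v - u by lra.
  have l01 : 0 < (v - w) / (v - u) < 1.
    by rewrite divr_gt0 ?ltr_pdivrMr//=; lra.
  have := lcF u v l01.
  have -> : (v - w) / (v - u) * u + (1 - (v - w) / (v - u)) * v = w.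
    by field; rewrite gt_eqF.
  have [Fu [Fv Fw]] := (F_gt0 _ au, (F_gt0 _ av, F_gt0 _ aw)).
  rewrite -ler_ln ?posrE ?mulr_gt0 ?powR_gt0// lnM ?posrE ?powR_gt0//.
  rewrite !ln_powR -(ler_pM2l uv0) /g /=; apply: le_trans.
  by rewrite le_eqVlt; apply/orP; left; apply/eqP; field; rewrite gt_eqF.
have cdg := concave_derive_continuous cg dg ax.
have : (fun y => F y * derive1 g y) @ x --> derive1 F x.
  have -> : derive1 F x = F x * derive1 g x.
    rewrite [X in _ * X]derive1E (@derive_val _ _ _ _ _ _ _ (isg _ ax)).
    by rewrite mulVKf// gt_eqF.
  by apply: cvgM => //; exact: contF.
apply: cvg_trans; apply: near_eq_cvg; near=> y.
have ay : a < y by near: y; exact: lt_nbhsr.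
rewrite [X in _ * X]derive1E (@derive_val _ _ _ _ _ _ _ (isg _ ay)).
by rewrite mulVKf// gt_eqF// F_gt0.
Unshelve. all: by end_near. Qed.

Let dens x := derive1 F x / (1 - F x) ^+ 2.

Let dens_ge0 x : 0 <= dens x.
Proof.
by rewrite divr_ge0 ?sqr_ge0//; exact: derive1_ge0_ndecr.
Qed.

Let mdens : measurable_fun setT dens.
Proof.
apply: measurable_funM; first exact: measurable_derive1.
apply: continuous_measurable_fun => x; apply: cvgV.
  by rewrite expf_neq0// gt_eqF// subr_gt0.
apply: (@continuous_comp _ _ _ (fun y => 1 - F y) (fun y => y ^+ 2)).
  by apply: cvgB; [exact: cvg_cst|exact: contF].
exact: exprn_continuous.
Qed.

Lemma odds_continuous : continuous (odds F).
Proof.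
move=> x; apply: differentiable_continuous; apply/derivable1_diffP.
by case: (is_derive_odds x).
Qed.

Let odds_FTC (u v : R) : 0 < F u -> u < v ->
  (\int[lebesgue_measure]_(x in `[u, v]) (dens x)%:E)%E =
  ((odds F v)%:E - (odds F u)%:E)%E.
Proof.
move=> Fu uv; apply: continuous_FTC2 => //.
- have cd x : u <= x -> {for x, continuous dens}.
    move=> ux; apply: cvgM.
      by apply: derive1_cdf_continuous; apply: lt_le_trans Fu (homoF ux).
    apply: cvgV; first by rewrite expf_neq0// gt_eqF// subr_gt0.
    apply: (@continuous_comp _ _ _ (fun y => 1 - F y) (fun y => y ^+ 2)).
      by apply: cvgB; [exact: cvg_cst|exact: contF].
    exact: exprn_continuous.
  apply: continuous_in_subspaceT => x.
  by rewrite inE/= in_itv/= => /andP[ux _]; exact: cd.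
- split.
  + by move=> x _; case: (is_derive_odds x).
  + exact/cvg_at_right_filter/odds_continuous.
  + exact/cvg_at_left_filter/odds_continuous.
- by move=> x _; rewrite derive1E; case: (is_derive_odds x).
Qed.

(** The fundamental theorem requires [F u > 0]. Otherwise it is applied from a point [w] where the
    odds equal a small [e], found by the intermediate value theorem, at the price of [e]. *)
Let odds_le_integral (u v : R) : u < v ->
  ((odds F v)%:E - (odds F u)%:E <=
   \int[lebesgue_measure]_(x in `[u, v]) (dens x)%:E)%E.
Proof.
move=> uv.
have I0 : (0 <= \int[lebesgue_measure]_(x in `[u, v]) (dens x)%:E)%E.
  by apply: integral_ge0 => x _; rewrite lee_fin.
have [Fu|Fu] := ltP 0 (F u); first by rewrite odds_FTC.
have Ou : odds F u = 0.
  by rewrite /odds (_ : F u = 0) ?mul0r//; apply/eqP; rewrite eq_le Fu cdf_ge0.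
rewrite Ou sube0; apply/lee_addgt0Pr => e e0.
have [Ov|Ov] := leP (odds F v) e.
  by apply: (@le_trans _ _ e%:E); rewrite ?lee_fin// leeDr.
have [w] : exists2 w, w \in `[u, v] & odds F w = e.
  apply: IVT; [exact: ltW| |].
    exact/continuous_subspaceT/odds_continuous.
  by rewrite ge_min le_max Ou (ltW e0) (ltW Ov) orbT.
rewrite in_itv/= => /andP[uw wv] Ow.
have {}wv : w < v.
  by rewrite lt_neqAle wv andbT; apply/eqP => wvE; move: Ov; rewrite -wvE Ow ltxx.
have Fw : 0 < F w.
  rewrite lt_neqAle cdf_ge0 andbT eq_sym; apply/eqP => Fw.
  by move: e0; rewrite -Ow /odds Fw mul0r ltxx.
rewrite -leeBlDr// -Ow -odds_FTC//; apply: ge0_subset_integral => //.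
- by apply/measurable_EFinP; exact: measurable_funTS.
- by move=> x _; rewrite lee_fin.
- by apply: subset_itvr; rewrite bnd_simp.
Qed.

(* Integer discretisation of the hazard condition: the weights [e^(-k)] and
   [e^(-x)] are comparable on [[k, k+1]]. *)
Lemma odds_weighted_increments : exists C : R, 0 <= C /\ forall N : nat,
  \sum_(k < N) expR (- k%:R) * (odds F k.+1%:R - odds F k%:R) <= C.
Proof.
case: PF => [_ [_ [_ [_ [_ [_ [_ [_ [CF ICF]]]]]]]]].
pose H x := dens x * expR (- x).
have mH : measurable_fun setT H.
  apply: measurable_funM => //.
  by apply: measurableT_comp => //; exact: measurable_funN.
have H0 x : 0 <= H x by rewrite mulr_ge0 ?expR_ge0.
have HE x : hazard F x * expR (- x) / (1 - F x) = H x.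
  rewrite hazardE /H /dens; field.
  by rewrite gt_eqF// subr_gt0.
have {}ICF : (\int[@lebesgue_measure R]_(x in `[0%R, +oo[) (H x)%:E <= CF%:E)%E.
  apply: le_trans ICF.
  have -> : [set x : R | (0 <= x)%R] = `[0, +oo[%classic.
    by apply/seteqP; split => x /=; rewrite in_itv/= andbT.
  by under [leRHS]eq_integral do rewrite HE.
have mHD (D : set R) : measurable_fun D (EFin \o H).
  by apply/measurable_EFinP; exact: measurable_funTS.
have scale (D : set R) (c : R) (f : R -> R) : measurable D -> 0 <= c ->
    measurable_fun setT f -> (forall x, 0 <= f x) ->
    (\int[lebesgue_measure]_(x in D) (c * f x)%:E =
     c%:E * \int[lebesgue_measure]_(x in D) (f x)%:E)%E.
  move=> mD c0 mf f0; under eq_integral do rewrite EFinM.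
  rewrite ge0_integralZl//.
  - by apply/measurable_EFinP; exact: measurable_funTS.
  - by move=> x _; rewrite lee_fin.
have step (k : nat) :
   ((expR (- k%:R) * (odds F k.+1%:R - odds F k%:R))%:E <=
    (expR 1)%:E * \int[lebesgue_measure]_(x in `[k%:R, k.+1%:R[) (H x)%:E)%E.
  have kk : (k%:R : R) < k.+1%:R by rewrite ltr_nat.
  have := odds_le_integral kk.
  rewrite integral_itv_bndo_bndc// -EFinB => le1.
  rewrite EFinM.
  apply: (@le_trans _ _ ((expR (- k%:R) : R)%:E *
      \int[lebesgue_measure]_(x in `[k%:R, k.+1%:R]) (dens x)%:E))%E.
    by apply: lee_wpmul2l; rewrite ?lee_fin ?expR_ge0.
  rewrite -!scale ?expR_ge0//.
  apply: ge0_le_integral => //.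
  - by move=> x _; rewrite lee_fin mulr_ge0// expR_ge0.
  - apply/measurable_EFinP; apply: measurable_funM => //.
    exact: measurable_funTS.
  - apply/measurable_EFinP; apply: measurable_funM => //.
    exact: measurable_funTS.
  move=> x /=; rewrite in_itv/= => /andP[_ xk].
  rewrite lee_fin /H [leRHS]mulrCA [leLHS]mulrC.
  apply: ler_wpM2l => //; rewrite -expRD ler_expR.
  by rewrite -natr1 in xk; lra.
have I0N (N : nat) :
   ((\sum_(k < N) expR (- k%:R) * (odds F k.+1%:R - odds F k%:R))%:E <=
    (expR 1)%:E * \int[lebesgue_measure]_(x in `[0%R, N%:R[) (H x)%:E)%E.
  elim: N => [|N IH].
    by rewrite big_ord0 mule_ge0 ?lee_fin ?expR_ge0// integral_ge0// => x _; rewrite lee_fin.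
  rewrite big_ord_recr/= EFinD; apply: le_trans (leeD IH (step N)) _.
  rewrite -ge0_muleDr; [|by apply: integral_ge0 => x _; rewrite lee_fin..].
  rewrite -ge0_integral_setU//; last first.
  - rewrite disj_set2E; apply/eqP/seteqP; split => // x [] /=.
    rewrite !in_itv/= => /andP[_ h1] /andP[h2 _].
    by move: (lt_le_trans h1 h2); rewrite ltxx.
  - by move=> x _; rewrite lee_fin.
  - exact: mHD.
  by rewrite -itv_bndbnd_setU// bnd_simp// ler_nat.
exists (expR 1 * `|CF|); split; first by rewrite mulr_ge0// expR_ge0.
move=> N; rewrite -lee_fin; apply: le_trans (I0N N) _.
rewrite EFinM; apply: lee_wpmul2l; first by rewrite lee_fin expR_ge0.
apply: (@le_trans _ _ CF%:E); last by rewrite lee_fin ler_norm.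
apply: le_trans ICF; apply: ge0_subset_integral => //.
- exact: mHD.
- by move=> x _; rewrite lee_fin.
- by apply: subset_itvl; rewrite bnd_simp.
Qed.

(** If [F g < y], then [F] stays below [y] slightly to the right of [g], although the superlevel set
    has points arbitrarily close to its infimum. The limit at [+oo] makes that set nonempty, without
    which [inf] carries no information. *)
Lemma cdf_Finv_ge (y g : R) : 0 < y < 1 -> Finv F y <= g -> y <= F g.
Proof.
move=> /andP[y0 y1] Fg.
have S0 : [set x | y <= F x] !=set0.
  have /cvgr_gt/(_ _ y1)[M [_ hM]] := F_y.
  by exists (M + 1) => /=; apply/ltW/hM; rewrite ltrDl.
rewrite leNgt; apply/negP => Fgy.
have yg : 0 < y - F g by rewrite subr_gt0.
have /cvgrPdist_lt/(_ _ yg)/nbhs_ballP[e /= e0 eF] : F y @[y --> g] --> F g by exact: contF.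
have [x /= yx xe] := @inf_lt _ _ (g + e) S0 ltac:(by apply: le_lt_trans Fg _; rewrite ltrDl).
have [gx|xg] := leP x g.
  by move: yx; rewrite leNgt (le_lt_trans (homoF gx) Fgy).
have : ball g e x by rewrite /ball/= distrC ger0_norm; lra.
move=> /eF; rewrite distrC ltr_norml => /andP[_]; lra.
Qed.

(** If [F g > y], continuity puts a point left of [g] into the superlevel set, below its infimum.
    The limit at [-oo] bounds the set from below. *)
Lemma cdf_Finv_le (y g : R) : 0 < y < 1 -> g <= Finv F y -> F g <= y.
Proof.
move=> /andP[y0 y1] gF.
have lb : has_lbound [set x | y <= F x].
  have /cvgr_lt/(_ _ y0)[M [_ hM]] := F_Ny.
  exists (M - 1) => x /= yx; rewrite leNgt; apply/negP => xM.
  have : F x < y by apply: hM; lra.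
  by rewrite ltNge yx.
rewrite leNgt; apply/negP => yFg.
have yg : 0 < F g - y by rewrite subr_gt0.
have /cvgrPdist_lt/(_ _ yg)/nbhs_ballP[e /= e0 eF] : F y @[y --> g] --> F g by exact: contF.
have : ball g e (g - e / 2).
  by rewrite /ball/= opprB addrC subrK ger0_norm ?divr_ge0//; lra.
move=> /eF; rewrite ltr_norml => /andP[_ h].
have : Finv F y <= g - e / 2 by apply: ge_inf => //=; lra.
lra.
Qed.

End perturbation.

(** * Independence *)

Section cylinders.
Context d (T : measurableType d) (R : realType) (I : eqType).
Variables (X : I -> T -> R) (J : seq I).

(** A pi-system generating the sigma-algebra of the variables indexed by [J]. *)
Definition cylinders : set (set T) :=
  [set E | exists B : I -> set R, (forall i, measurable (B i)) /\
    E = \big[setI/setT]_(i <- J) (X i @^-1` B i)].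

Lemma cylinders_setI : setI_closed cylinders.
Proof.
move=> _ _ [B1 [mB1 ->]] [B2 [mB2 ->]].
exists (fun i => B1 i `&` B2 i); split; first by move=> i; exact: measurableI.
by rewrite -big_split/=; apply: eq_bigr => i _; rewrite preimage_setI.
Qed.

Lemma cylinders_setT : cylinders setT.
Proof.
exists (fun=> setT); split => //.
by rewrite big1// => i _; rewrite preimage_setT.
Qed.

Lemma cylinders_measurable : {in J, forall i, measurable_fun setT (X i)} ->
  cylinders `<=` measurable.
Proof.
move=> mX _ [B [mB ->]]; rewrite big_seq.
elim/big_ind : _ => [//|A1 A2|i iJ]; first exact: measurableI.
by rewrite -[X in measurable X]setTI; exact: mX.
Qed.

Lemma sigma_cylinders_measurable :
  {in J, forall i, measurable_fun setT (X i)} -> <<s cylinders >> `<=` measurable.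
Proof.
move=> mX; apply: smallest_sub; last exact: cylinders_measurable.
by split; [exact: measurable0|by move=> A mA; rewrite setTD; exact: measurableC|
  exact: bigcupT_measurable].
Qed.

Lemma measurable_fun_cylinders (i : I) : uniq J -> i \in J ->
  @measurable_fun _ _ (g_sigma_algebraType cylinders) R setT (X i).
Proof.
move=> uJ iJ _ B mB; rewrite setTI; apply: sub_sigma_algebra.
exists (fun k => if k == i then B else setT); split.
  by move=> k; case: ifP.
rewrite (bigD1_seq i)//= eqxx big1 ?setIT// => k ki.
by rewrite (negPf ki) preimage_setT.
Qed.

End cylinders.

Section independence.
Context d (T : measurableType d) (R : realType) (P : probability T R).
Context (I : eqType).
Variables (D : pred I) (X : I -> T -> R).
Hypothesis indX : mutually_independent P D X.
Hypothesis mX : forall i, D i -> measurable_fun setT (X i).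

(** The finite measures [P (. & Y)] and [P (.) * P Y], with [Y] the event on [X j], agree on the
    pi-system of cylinders, hence on the sigma-algebra it generates. *)
Lemma independent_cylinders (J : seq I) (j : I) (E : set T) (B : set R) :
  uniq (j :: J) -> all D (j :: J) -> <<s cylinders X J >> E -> measurable B ->
  P (E `&` X j @^-1` B) = (P E * P (X j @^-1` B))%E.
Proof.
move=> ujJ /= /andP[Dj DJ] sE mB.
have mXJ : {in J, forall i, measurable_fun setT (X i)}.
  by move=> i iJ; apply: mX; exact: (allP DJ).
have mY : measurable (X j @^-1` B) by rewrite -[X in measurable X]setTI; exact: mX.
set Y := X j @^-1` B in mY *.
have pY : 0 <= fine (P Y) by exact/fine_ge0/measure_ge0.
pose m1 := mrestr P mY; pose m2 := mscale (NngNum pY) P.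
suff : m1 E = m2 E.
  by rewrite /m1 /m2/= /mrestr /mscale/= fineK ?fin_num_measure// muleC.
apply: (g_sigma_algebra_measure_unique (cylinders X J) _ (fun=> setT)) => //.
- exact: cylinders_measurable.
- by move=> _; exact: cylinders_setT.
- by apply/seteqP; split => // x _; exists 0%N.
- exact: cylinders_setI.
- move=> _ [B' [mB' ->]]; rewrite /m1 /m2/= /mrestr /mscale/=.
  (* As [j] is not in [J], this one family serves in the independence hypothesis for both [j :: J]
     and [J]. *)
  pose B2 i := if i == j then B else B' i.
  have mB2 i : measurable (B2 i) by rewrite /B2; case: ifP.
  move: (ujJ) => /= /andP[jJ uJ].
  have E2 : \big[setI/setT]_(i <- J) (X i @^-1` B' i) =
      \big[setI/setT]_(i <- J) (X i @^-1` B2 i).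
    rewrite big_seq [RHS]big_seq; apply: eq_bigr => i iJ; rewrite /B2.
    by case: eqP => // ij; move: jJ; rewrite -ij iJ.
  have mC : measurable (\big[setI/setT]_(i <- J) (X i @^-1` B2 i)).
    by apply: (cylinders_measurable mXJ); exists B2.
  have h1 := indX ujJ (introT andP (conj Dj DJ)) mB2.
  have h2 := indX uJ DJ mB2.
  rewrite !big_cons/= -h2 in h1.
  rewrite E2 setIC -[LHS]fineK; last first.
    by rewrite fin_num_measure//; exact: measurableI.
  by move: h1; rewrite {1 3}/B2 eqxx => ->; rewrite EFinM !fineK// fin_num_measure.
- by move=> _; rewrite /m1/= /mrestr setTI ltey_eq fin_num_measure.
Qed.

End independence.

(** The joint law of [(U, V)] is the product of the two laws, so Tonelli applies. *)
Lemma expectation_indepM d (T : measurableType d) (R : realType)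
    (P : probability T R) (U V : T -> R) :
  measurable_fun setT U -> measurable_fun setT V ->
  (forall w, 0 <= U w) -> (forall w, 0 <= V w) ->
  (forall A B, measurable A -> measurable B ->
    P (U @^-1` A `&` V @^-1` B) = (P (U @^-1` A) * P (V @^-1` B))%E) ->
  (\int[P]_w (U w * V w)%:E = \int[P]_w (U w)%:E * \int[P]_w (V w)%:E)%E.
Proof.
move=> mU mV U0 V0 ind.
have mUV : measurable_fun setT (fun w => (U w, V w)).
  exact: measurable_fun_pair.
pose hU : {RV P >-> R} := HB.pack U (isMeasurableFun.Build _ _ _ _ U mU).
pose hV : {RV P >-> R} := HB.pack V (isMeasurableFun.Build _ _ _ _ V mV).
pose hUV : {RV P >-> (R * R)%type} :=
  HB.pack (fun w => (U w, V w)) (isMeasurableFun.Build _ _ _ _ _ mUV).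
(* The absolute value makes the integrand nonnegative on the whole plane; it changes nothing on the
   range of [(U, V)]. *)
pose f (z : R * R) : \bar R := `|z.1 * z.2|%:E.
have mf : measurable_fun setT f.
  apply/measurable_EFinP; apply: measurableT_comp => //.
  by apply: measurable_funM; [exact: measurable_fst|exact: measurable_snd].
have f0 z : (0 <= f z)%E by rewrite lee_fin.
have mnorm : measurable_fun setT (fun x : R => (`|x|%:E : \bar R)).
  by apply/measurable_EFinP; exact: normr_measurable.
transitivity (\int[distribution P hUV]_z f z)%E.
  rewrite ge0_integral_distribution//.
  by apply: eq_integral => w _; rewrite /f/= ger0_norm// mulr_ge0.
transitivity (\int[distribution P hU \x distribution P hV]_z f z)%E.
  apply: eq_measure_integral => A mA _; symmetry.
  exact: product_measure_unique.
rewrite fubini_tonelli1//.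
have inner x : fubini_F (distribution P hV) f x =
    (`|x|%:E * \int[P]_w (V w)%:E)%E.
  rewrite /fubini_F /f/=; under eq_integral do rewrite normrM EFinM.
  rewrite ge0_integralZl//; congr (_ * _)%E.
  rewrite (ge0_integral_distribution hV)//.
  by apply: eq_integral => w _ /=; rewrite ger0_norm.
under eq_integral do rewrite inner muleC.
rewrite ge0_integralZl//; last first.
  by apply: integral_ge0 => w _; rewrite lee_fin.
rewrite muleC; congr (_ * _)%E.
rewrite (ge0_integral_distribution hU)//.
by apply: eq_integral => w _ /=; rewrite ger0_norm.
Qed.

(** * Measurability of the algorithm *)

(** Histories and actions live in countable types, where singleton preimages determine
    measurability, so no sigma-algebra on the codomain is needed. *)
Definition discretely_measurable d (T : measurableType d) (D : Type)
  (f : T -> D) := forall x, measurable (f @^-1` [set x]).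

Lemma measurable_fun_discrete_comp d (T : measurableType d) d'
    (T' : measurableType d') (D : countType) (f : T -> D) (phi : D -> T -> T') :
  discretely_measurable f -> (forall x, measurable_fun setT (phi x)) ->
  measurable_fun setT (fun w => phi (f w) w).
Proof.
move=> mf mphi _ B mB; rewrite setTI.
have -> : (fun w => phi (f w) w) @^-1` B =
    \bigcup_x (f @^-1` [set x] `&` phi x @^-1` B).
  apply/seteqP; split => [w /= Bw|w [x _ [/= <-]]//].
  by exists (f w).
apply: countable_bigcupT_measurable; first exact: countableP.
move=> x; apply: measurableI; first exact: mf.
by rewrite -[X in measurable X]setTI; exact: mphi.
Qed.

Lemma discretely_measurable_comp d (T : measurableType d) (D : countType)
    (E : Type) (f : T -> D) (phi : D -> T -> E) :
  discretely_measurable f -> (forall x, discretely_measurable (phi x)) ->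
  discretely_measurable (fun w => phi (f w) w).
Proof.
move=> mf mphi y.
have -> : (fun w => phi (f w) w) @^-1` [set y] =
    \bigcup_x (f @^-1` [set x] `&` phi x @^-1` [set y]).
  apply/seteqP; split => [w /= Bw|w [x _ [/= <-]]//].
  by exists (f w).
apply: countable_bigcupT_measurable; first exact: countableP.
by move=> x; apply: measurableI; [exact: mf|exact: mphi].
Qed.

Lemma discretely_measurable_cst d (T : measurableType d) (D : Type) (x : D) :
  discretely_measurable (fun _ : T => x).
Proof.
move=> y; have [xy|xy] := pselect (x = y).
  by rewrite (_ : _ @^-1` _ = setT)//; apply/seteqP; split.
by rewrite (_ : _ @^-1` _ = set0)//; apply/seteqP; split.
Qed.

Lemma measurable_bool_set d (T : measurableType d) (b : T -> bool) :
  measurable_fun setT b -> measurable [set w | b w].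
Proof. by move=> mb; rewrite -[X in measurable X]setTI; exact: mb. Qed.

Lemma discretely_measurable_pred d (T : measurableType d) (D : countType)
    (f : T -> D) (Q : D -> bool) :
  discretely_measurable f -> measurable_fun setT (fun w => Q (f w)).
Proof.
move=> mf; exact: (measurable_fun_discrete_comp (phi := fun x _ => Q x) mf).
Qed.

Section argmax.
Context d (T : measurableType d) (R : realType) (A : finType) (a0 : A).
Variable idx : A -> T -> R.
Hypothesis midx : forall a, measurable_fun setT (idx a).

(** The selected arm, ties included, is a function of the finite table recording which arms are
    maximal, and each entry of that table is a finite conjunction of comparisons. *)
Lemma discretely_measurable_argmax :
  discretely_measurable (fun w => [arg max_(a > a0) idx a w]%O).
Proof.
pose M w : {ffun A -> bool} := [ffun i => [forall j, idx j w <= idx i w]].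
pose pickM (S : {ffun A -> bool}) := odflt a0 [pick i | S i].
have -> : (fun w => [arg max_(a > a0) idx a w]%O) = (fun w => pickM (M w)).
  apply/funext => w; rewrite /pickM /Order.arg_max /extremum.
  congr odflt; apply: eq_pick => i; rewrite ffunE /=.
  by apply: eq_forallb => j.
apply: (@discretely_measurable_comp _ _ _ _ M (fun S _ => pickM S)); last first.
  by move=> S; exact: discretely_measurable_cst.
move=> S.
have -> : M @^-1` [set S] =
    \big[setI/setT]_(i : A) [set w | [forall j, idx j w <= idx i w] == S i].
  apply/seteqP; split => [w /= <-|w].
    by apply: (big_ind (fun B : set T => B w)) => // i _ /=; rewrite ffunE.
  move=> h; apply/ffunP => i.
  by move: h; rewrite (bigD1 i)//= => -[/eqP <- _]; rewrite ffunE.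
elim/big_ind : _ => // [A1 A2|i _]; first exact: measurableI.
have mb : measurable_fun setT (fun w => [forall j, idx j w <= idx i w]).
  have -> : (fun w => [forall j, idx j w <= idx i w]) =
      (fun w => \big[andb/true]_j (idx j w <= idx i w)).
    by apply/funext => w; rewrite big_andE.
  elim: (index_enum A) => [|j s IH].
    by under eq_fun do rewrite big_nil; exact: measurable_cst.
  under eq_fun do rewrite big_cons.
  by apply: measurable_and => //; exact: measurable_fun_ler.
rewrite (_ : [set w | _] = (fun w => [forall j, idx j w <= idx i w]) @^-1` [set S i]).
  by rewrite -[X in measurable X]setTI; exact: mb.
by apply/seteqP; split => w /=; [move/eqP|move=> ->; exact: eqxx].
Qed.

End argmax.

Section algorithm.
Context d (T : measurableType d) (R : realType) (A : finType) (a0 : A).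
Variables (c p : R) (rw g : nat -> A -> T -> R).
Let rww w k b := rw k b w.
Let gw w k b := g k b w.

Lemma measurable_est (h : seq A) (a : A) :
  (forall k, (0 < k <= size h)%N -> measurable_fun setT (rw k a)) ->
  measurable_fun setT (fun w => ape2_est c p (rww w) h a).
Proof.
move=> mrw.
have -> : (fun w => ape2_est c p (rww w) h a) = (fun w =>
    c / (pulls h a)%:R `^ (1 - p^-1) * \sum_(k < size h)
      if nth a h k == a then
        psi_p p (rw k.+1 a w / (c * (pulls h a)%:R `^ p^-1)) else 0).
  by apply/funext => w; rewrite /ape2_est big_mkcond.
apply: measurable_funM => //; apply: measurable_sum => k.
case: (nth a h k == a) => //; apply: (measurableT_comp (measurable_psi_p p)).
by apply: measurable_funM => //; apply: mrw => /=.
Qed.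

Lemma discretely_measurable_choose (t : nat) (h : seq A) : (0 < t)%N ->
  (forall k a, (0 < k <= size h)%N -> measurable_fun setT (rw k a)) ->
  (forall a, measurable_fun setT (g t a)) ->
  discretely_measurable (fun w => ape2_choose a0 c p (rww w) (gw w) t h).
Proof.
move=> t0 mrw mg; rewrite /ape2_choose; case: (t <= #|A|)%N.
  exact: discretely_measurable_cst.
apply: (@discretely_measurable_argmax _ _ _ _ _
  (fun a w => ape2_est c p (rww w) h a + ape2_beta c p h a * gw w t a)) => a.
apply: measurable_funD; first by apply: measurable_est; move=> k; exact: mrw.
by apply: measurable_funM => //; exact: mg.
Qed.

Lemma size_ape2_hist rw' g' t : size (ape2_hist a0 c p rw' g' t) = t.
Proof. by elim: t => //= t IH; rewrite size_rcons IH. Qed.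

(** The bounds are asymmetric because the action of round [t] sees the perturbations of round [t]
    but only earlier rewards. This precision lets the lemma be applied with sub-sigma-algebras
    generated by the past. *)
Lemma discretely_measurable_hist (t : nat) :
  (forall k a, (0 < k < t)%N -> measurable_fun setT (rw k a)) ->
  (forall k a, (0 < k <= t)%N -> measurable_fun setT (g k a)) ->
  discretely_measurable (fun w => ape2_hist a0 c p (rww w) (gw w) t).
Proof.
elim: t => [|t IH] mrw mg /=; first exact: discretely_measurable_cst.
have mh : discretely_measurable (fun w => ape2_hist a0 c p (rww w) (gw w) t).
  apply: IH => k a /andP[k0 kt]; [apply: mrw|apply: mg]; rewrite k0/=.
    exact: ltn_trans kt _.
  exact: leq_trans kt _.
(* The default [[::]] on other lengths confines the measurability obligation to histories of length
   [t]. *)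
pose phi (h : seq A) w := if size h == t then
  rcons h (ape2_choose a0 c p (rww w) (gw w) t.+1 h) else [::].
have -> : (fun w => let h := ape2_hist a0 c p (rww w) (gw w) t in
   rcons h (ape2_choose a0 c p (rww w) (gw w) t.+1 h)) =
   fun w => phi (ape2_hist a0 c p (rww w) (gw w) t) w.
  by apply/funext => w; rewrite /phi size_ape2_hist eqxx.
apply: discretely_measurable_comp => // h; rewrite /phi.
have [ht|_] := eqVneq (size h) t; last exact: discretely_measurable_cst.
apply: (@discretely_measurable_comp _ _ A _
  (fun w => ape2_choose a0 c p (rww w) (gw w) t.+1 h) (fun b _ => rcons h b)).
  apply: discretely_measurable_choose => //.
    by move=> k a; rewrite ht => kt; apply: mrw; rewrite ltnS.
  by move=> a; apply: mg; rewrite ltn0Sn leqnn.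
by move=> b; exact: discretely_measurable_cst.
Qed.

Lemma measurable_fun_hist d' (T' : measurableType d') (t : nat)
    (phi : seq A -> T -> T') :
  (forall k a, (0 < k < t)%N -> measurable_fun setT (rw k a)) ->
  (forall k a, (0 < k <= t)%N -> measurable_fun setT (g k a)) ->
  (forall h, size h = t -> measurable_fun setT (phi h)) ->
  measurable_fun setT (fun w => phi (ape2_hist a0 c p (rww w) (gw w) t) w).
Proof.
move=> mrw mg mphi.
pose psi (h : seq A) w := if size h == t then phi h w else point.
have -> : (fun w => phi (ape2_hist a0 c p (rww w) (gw w) t) w) =
    (fun w => psi (ape2_hist a0 c p (rww w) (gw w) t) w).
  by apply/funext => w; rewrite /psi size_ape2_hist eqxx.
apply: measurable_fun_discrete_comp; first exact: discretely_measurable_hist.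
move=> h; rewrite /psi; have [ht|_] := eqVneq (size h) t; last by [].
exact: mphi.
Qed.

End algorithm.

(** * Concentration of the estimator *)

Section bandit.
Context (R : realType) (c p nu : R) (A : finType) (a0 : A).
Context (d : measure_display) (Omega : measurableType d) (P : probability Omega R).
Variables (Rw G : nat -> A -> Omega -> R) (r : A -> R).
Hypotheses (c0 : 0 < c) (p12 : 1 < p <= 2).
Hypothesis mRw : forall t a, (0 < t)%N -> measurable_fun setT (Rw t a).
Hypothesis mG : forall t a, (0 < t)%N -> measurable_fun setT (G t a).
Hypothesis ERw : forall t a, (0 < t)%N ->
  (\int[P]_w (Rw t a w)%:E = (r a)%:E)%E.
Hypothesis Epow : forall t a, (0 < t)%N ->
  (\int[P]_w (`|Rw t a w| `^ p)%:E <= nu%:E)%E.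

Lemma integrable_reward t a : (0 < t)%N ->
  P.-integrable setT (EFin \o (fun w => `|Rw t a w| `^ p)) /\
  P.-integrable setT (EFin \o Rw t a).
Proof.
move=> t0; have mR := mRw a t0.
have mpow : measurable_fun setT (fun w => `|Rw t a w| `^ p).
  apply: (measurableT_comp (measurable_powR p)).
  exact: measurableT_comp.
have ipow : P.-integrable setT (EFin \o (fun w => `|Rw t a w| `^ p)).
  apply/integrableP; split; first exact/measurable_EFinP.
  under eq_integral do rewrite /= ger0_norm ?powR_ge0//.
  exact: le_lt_trans (Epow a t0) (ltry _).
split => //.
have i1 : P.-integrable setT (EFin \o (fun w => 1 + `|Rw t a w| `^ p)).
  exact: (integrableD measurableT (finite_measure_integrable_cst P 1 measurableT) ipow).
apply: le_integrable i1 => //; first exact/measurable_EFinP.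
move=> w _ /=; rewrite lee_fin [leRHS]ger0_norm ?addr_ge0 ?powR_ge0//.
have [x1|x1] := leP `|Rw t a w| 1.
  by apply: le_trans x1 _; rewrite lerDl powR_ge0.
apply: (@le_trans _ _ (`|Rw t a w| `^ p)); last by rewrite lerDr.
by apply: le1r_powR; [exact: ltW|case/andP: p12 => /ltW].
Qed.

(** [psi_p_bounds] replaces the exponential by an integrable function of the reward, and
    [1 + x <= e^x] puts its mean back in the exponent. The two values of [e] serve the two tails;
    [|nu|] avoids any assumption on the sign of [nu]. *)
Lemma exp_moment_psi t a (e s : R) : (0 < t)%N -> e = 1 \/ e = -1 -> 0 < s ->
  (\int[P]_w (expR (e * psi_p p (Rw t a w / s)))%:E <=
   (expR (e * r a / s + b_p p * `|nu| / s `^ p))%:E)%E.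
Proof.
move=> t0 e1 s0; have [ipow iR] := integrable_reward a t0.
have mR := mRw a t0.
have b0 : 0 <= b_p p by exact/ltW/b_p_gt0.
have sp0 : 0 < s `^ p by exact: powR_gt0.
pose k1 := e / s; pose k2 := b_p p / s `^ p.
have k20 : 0 <= k2 by rewrite divr_ge0// ltW.
pose f w := 1 + k1 * Rw t a w + k2 * `|Rw t a w| `^ p.
have fE w : expR (e * psi_p p (Rw t a w / s)) <= f w.
  have [b1 b2] := psi_p_bounds (Rw t a w / s) p12.
  rewrite /f /k1 /k2; set x := Rw t a w in b1 b2 *.
  have E2 : b_p p * `|x / s| `^ p = b_p p / s `^ p * `|x| `^ p.
    rewrite normrM powRM// [`|s^-1|]ger0_norm ?invr_ge0 ?(ltW s0)//.
    rewrite -[s^-1]powR_inv1 ?(ltW s0)// powRAC powR_inv1 ?powR_ge0//.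
    by ring.
  rewrite E2 in b1 b2.
  by case: e1 => ->; [rewrite mul1r; apply: le_trans b1 _|
    rewrite mulN1r; apply: le_trans b2 _];
    rewrite le_eqVlt; apply/orP; left; apply/eqP; ring.
have i1 : P.-integrable setT (fun w => (1 + k1 * Rw t a w)%:E).
  exact: (integrableD measurableT (finite_measure_integrable_cst P 1 measurableT)
    (integrableZl measurableT k1 iR)).
have i2 : P.-integrable setT (fun w => (k2 * `|Rw t a w| `^ p)%:E).
  exact: (integrableZl measurableT k2 ipow).
apply: (@le_trans _ _ (\int[P]_w (f w)%:E)%E).
  apply: ge0_le_integral => //.
  - apply/measurable_EFinP; apply: measurableT_comp => //.
    apply: measurable_funM => //; apply: (measurableT_comp (measurable_psi_p p)).
    exact: measurable_funM.
  - by have /measurable_int := integrableD measurableT i1 i2.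
  - by move=> w _; rewrite lee_fin.
rewrite /f; under eq_integral do rewrite EFinD.
rewrite integralD//.
have -> : (\int[P]_w (1 + k1 * Rw t a w)%:E = (1 + k1 * r a)%:E)%E.
  under eq_integral do rewrite EFinD.
  rewrite (integralD measurableT (finite_measure_integrable_cst P 1 measurableT)
    (integrableZl measurableT k1 iR)).
  have -> : (\int[P]_w (EFin \o cst (1 : R)%R) w = 1)%E.
    exact: etrans (integral_cst P measurableT 1%E) (etrans (mul1e _) (probability_setT P)).
  by rewrite integralZl// ERw// EFinD EFinM.
under eq_integral do rewrite EFinM.
rewrite integralZl//.
apply: (@le_trans _ _ ((1 + k1 * r a)%:E + k2%:E * `|nu|%:E)%E).
  apply: leeD => //; apply: lee_wpmul2l; first by rewrite lee_fin.
  by apply: le_trans (Epow a t0) _; rewrite lee_fin ler_norm.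
rewrite -EFinM -EFinD lee_fin.
apply: le_trans (expR_ge1Dx _); rewrite -addrA lerD2l /k1 /k2.
by rewrite le_eqVlt; apply/orP; left; apply/eqP; ring.
Qed.

End bandit.

(** * Independence of each reward and perturbation from the past *)

Section filtration.
Context (R : realType) (c p : R) (A : finType) (a0 : A).
Context (d : measure_display) (Omega : measurableType d) (P : probability Omega R).
Variables (Rw G : nat -> A -> Omega -> R).
Hypothesis mRw : forall t a, (0 < t)%N -> measurable_fun setT (Rw t a).
Hypothesis mG : forall t a, (0 < t)%N -> measurable_fun setT (G t a).

Let I := ((nat * A) + (nat * A))%type.
Let X (i : I) := match i with inl (t, a) => Rw t a | inr (t, a) => G t a end.
Let D : pred I :=
  fun i => match i with inl (t, _) | inr (t, _) => (0 < t)%N end.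
Hypothesis ind : mutually_independent P D X.

Let mX i : D i -> measurable_fun setT (X i).
Proof. by case: i => -[t a]; [exact: mRw|exact: mG]. Qed.

Definition hist t w :=
  ape2_hist a0 c p (fun k b => Rw k b w) (fun k b => G k b w) t.
Definition act t w :=
  ape2_action a0 c p (fun k b => Rw k b w) (fun k b => G k b w) t.

Lemma histS t w : hist t.+1 w = rcons (hist t w) (act t.+1 w).
Proof. by rewrite /act /ape2_action /hist /= last_rcons. Qed.

Lemma size_hist t w : size (hist t w) = t.
Proof. exact: size_ape2_hist. Qed.

(** Rewards up to round [t] but perturbations up to round [t + 1]: together they determine the
    action of round [t + 1]. *)
Definition round_indices (t : nat) : seq I :=
  [seq inl (s, b) | s <- iota 1 t, b <- enum A] ++
  [seq inr (s, b) | s <- iota 1 t.+1, b <- enum A].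

Lemma round_indices_uniq t : uniq (round_indices t).
Proof.
rewrite cat_uniq; apply/and3P; split.
- by apply: allpairs_uniq; rewrite ?iota_uniq ?enum_uniq// => -[? ?] [? ?] _ _ [-> ->].
- by apply/hasPn => _ /allpairsP[[s b] [_ _ ->]]; apply/negP => /allpairsP[[? ?] [_ _ //]].
- by apply: allpairs_uniq; rewrite ?iota_uniq ?enum_uniq// => -[? ?] [? ?] _ _ [-> ->].
Qed.

Lemma mem_inl_round_indices t s b :
  (inl (s, b) \in round_indices t) = (0 < s <= t)%N.
Proof.
rewrite mem_cat; apply/orP/idP =>
  [[/allpairsP[[s' b'] [h _ [= -> _]]]|/allpairsP[[s' b'] [_ _ //]]]|st].
  by rewrite mem_iota add1n ltnS in h.
left; apply/allpairsP; exists (s, b); split => //; last by rewrite mem_enum.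
by rewrite mem_iota add1n ltnS.
Qed.

Lemma mem_inr_round_indices t s b :
  (inr (s, b) \in round_indices t) = (0 < s <= t.+1)%N.
Proof.
rewrite mem_cat; apply/orP/idP =>
  [[/allpairsP[[s' b'] [_ _ //]]|/allpairsP[[s' b'] [h _ [= -> _]]]]|st].
  by rewrite mem_iota add1n ltnS in h.
right; apply/allpairsP; exists (s, b); split => //; last by rewrite mem_enum.
by rewrite mem_iota add1n ltnS.
Qed.

Lemma round_indices_pos t : all D (round_indices t).
Proof.
apply/allP => -[] [s b]; rewrite ?mem_inl_round_indices ?mem_inr_round_indices.
  by case/andP.
by case/andP.
Qed.

(* everything round [t + 1] depends on except its rewards *)
Definition before_reward t := cylinders X (round_indices t).

(* everything round [t + 1] depends on except its rewards and [G_{t+1,a}] *)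
Definition before_perturbation t a :=
  cylinders X (rem (inr (t.+1, a)) (round_indices t)).

Lemma indep_reward t a E B : <<s before_reward t >> E -> measurable B ->
  P (E `&` Rw t.+1 a @^-1` B) = (P E * P (Rw t.+1 a @^-1` B))%E.
Proof.
apply: (independent_cylinders ind mX (j := inl (t.+1, a))) => /=.
  by rewrite round_indices_uniq mem_inl_round_indices ltnn andbF.
exact: round_indices_pos.
Qed.

Lemma indep_perturbation t a E B : <<s before_perturbation t a >> E ->
  measurable B -> P (E `&` G t.+1 a @^-1` B) = (P E * P (G t.+1 a @^-1` B))%E.
Proof.
apply: (independent_cylinders ind mX (j := inr (t.+1, a))) => /=.
  by rewrite rem_uniq ?round_indices_uniq// mem_rem_uniq ?round_indices_uniq// inE eqxx.
by apply/allP => i /mem_rem /(allP (round_indices_pos t)).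
Qed.

Lemma reward_before_reward t k a : (0 < k <= t)%N ->
  @measurable_fun _ _ (g_sigma_algebraType (before_reward t)) R setT (Rw k a).
Proof.
move=> kt; apply: (measurable_fun_cylinders (i := inl (k, a))).
  exact: round_indices_uniq.
by rewrite mem_inl_round_indices.
Qed.

Lemma perturbation_before_reward t k a : (0 < k <= t.+1)%N ->
  @measurable_fun _ _ (g_sigma_algebraType (before_reward t)) R setT (G k a).
Proof.
move=> kt; apply: (measurable_fun_cylinders (i := inr (k, a))).
  exact: round_indices_uniq.
by rewrite mem_inr_round_indices.
Qed.

Lemma reward_before_perturbation t b k a : (0 < k <= t)%N ->
  @measurable_fun _ _ (g_sigma_algebraType (before_perturbation t b)) R setT (Rw k a).
Proof.
move=> kt; apply: (measurable_fun_cylinders (i := inl (k, a))).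
  by rewrite rem_uniq ?round_indices_uniq.
by rewrite mem_rem_uniq ?round_indices_uniq// inE/= mem_inl_round_indices.
Qed.

Lemma perturbation_before_perturbation t b k a : (0 < k <= t.+1)%N ->
  (k, a) != (t.+1, b) ->
  @measurable_fun _ _ (g_sigma_algebraType (before_perturbation t b)) R setT (G k a).
Proof.
move=> kt ka; apply: (measurable_fun_cylinders (i := inr (k, a))).
  by rewrite rem_uniq ?round_indices_uniq.
by rewrite mem_rem_uniq ?round_indices_uniq// inE/= mem_inr_round_indices kt andbT.
Qed.

Lemma expectation_reward t a (U : Omega -> R) (f : R -> R) :
  @measurable_fun _ _ (g_sigma_algebraType (before_reward t)) R setT U ->
  measurable_fun setT f -> (forall w, 0 <= U w) -> (forall x, 0 <= f x) ->
  (\int[P]_w (U w * f (Rw t.+1 a w))%:E =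
   \int[P]_w (U w)%:E * \int[P]_w (f (Rw t.+1 a w))%:E)%E.
Proof.
move=> mU mf U0 f0.
have sub : <<s before_reward t >> `<=` measurable.
  apply: sigma_cylinders_measurable => i /(allP (round_indices_pos t)).
  exact: mX.
apply: expectation_indepM => //.
- move=> _ B mB; apply: sub.
  exact: (mU measurableT B mB).
- by apply: measurableT_comp => //; exact: mRw.
move=> B1 B2 mB1 mB2; apply: (@indep_reward t a (U @^-1` B1) (f @^-1` B2)); last first.
  by rewrite -[X in measurable X]setTI; exact: mf.
by have := mU measurableT B1 mB1; rewrite setTI.
Qed.

End filtration.

Lemma pulls_rcons (A : finType) (h : seq A) (a b : A) :
  pulls (rcons h b) a = (pulls h a + (b == a))%N.
Proof. by rewrite /pulls -cats1 count_cat /= addn0. Qed.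

(** * The truncated exponential supermartingale *)

Section telescoping.
Context (R : realType) (c p : R) (A : finType) (a0 : A).
Context (d : measure_display) (Omega : measurableType d) (P : probability Omega R).
Variables (Rw G : nat -> A -> Omega -> R).
Hypothesis mRw : forall t a, (0 < t)%N -> measurable_fun setT (Rw t a).
Hypothesis mG : forall t a, (0 < t)%N -> measurable_fun setT (G t a).
Hypothesis ind : mutually_independent P
  (fun i : (nat * A) + (nat * A) =>
     match i with inl (t, _) | inr (t, _) => (0 < t)%N end)
  (fun i => match i with
            | inl (t, a) => Rw t a
            | inr (t, a) => G t a end).

Notation H := (hist c p a0 Rw G).
Notation act := (act c p a0 Rw G).

Lemma measurable_of_before_reward t d' (T' : measurableType d') (U : Omega -> T') :
  @measurable_fun _ _ (g_sigma_algebraType (before_reward Rw G t)) T' setT U ->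
  measurable_fun setT U.
Proof.
move=> mU _ B mB; apply: (sigma_cylinders_measurable _ (mU measurableT B mB)).
move=> i /(allP (round_indices_pos _ t)); case: i => -[s b]; [exact: mRw|exact: mG].
Qed.

Lemma hist_before_reward t s : (s <= t.+1)%N ->
  discretely_measurable (T := g_sigma_algebraType (before_reward Rw G t)) (H s).
Proof.
move=> st; apply: discretely_measurable_hist => k b /andP[k0 ks].
  by apply: reward_before_reward; rewrite k0 -ltnS (leq_trans ks).
by apply: perturbation_before_reward; rewrite k0 (leq_trans ks).
Qed.

Lemma hist_measurable t : discretely_measurable (H t).
Proof.
by apply: discretely_measurable_hist => k b /andP[k0 _]; [exact: mRw|exact: mG].
Qed.

Section arm.
Variables (a : A) (s e m : R).

Definition psi_sum (h : seq A) (w : Omega) : R :=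
  \sum_(k < size h | nth a h k == a) psi_p p (Rw k.+1 a w / s).

Lemma psi_sum_rcons h b w : psi_sum (rcons h b) w =
  psi_sum h w + (if b == a then psi_p p (Rw (size h).+1 a w / s) else 0).
Proof.
rewrite /psi_sum big_mkcond size_rcons big_ord_recr/= nth_rcons ltnn eqxx.
rewrite [in RHS]big_mkcond; congr (_ + _).
by apply: eq_bigr => i _; rewrite nth_rcons ltn_ord.
Qed.

(** Here [s] stays fixed while pulls accumulate, unlike the scale inside the estimator. The process
    is compared with the estimator only when the number of pulls is the one for which [s] was
    chosen. *)
Definition exp_psi (h : seq A) (w : Omega) : R :=
  expR (e * psi_sum h w - m * (pulls h a)%:R).

Lemma measurable_exp_psi d' (T' : measurableType d') (rw : nat -> A -> T' -> R) h :
  (forall k, (0 < k <= size h)%N -> measurable_fun setT (rw k a)) ->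
  measurable_fun setT (fun w => expR (e * (\sum_(k < size h | nth a h k == a)
    psi_p p (rw k.+1 a w / s)) - m * (pulls h a)%:R)).
Proof.
move=> mrw; apply: measurableT_comp => //; apply: measurable_funB => //.
apply: measurable_funM => //.
have -> : (fun w => \sum_(k < size h | nth a h k == a) psi_p p (rw k.+1 a w / s))
  = (fun w => \sum_(k < size h)
      if nth a h k == a then psi_p p (rw k.+1 a w / s) else 0).
  by apply/funext => w; rewrite big_mkcond.
apply: measurable_sum => k.
case: (nth a h k == a) => //; apply: (measurableT_comp (measurable_psi_p p)).
by apply: measurable_funM => //; apply: mrw => /=.
Qed.

Lemma exp_psi_before_reward t :
  measurable_fun (T := g_sigma_algebraType (before_reward Rw G t)) setT
    (fun w => exp_psi (H t w) w).
Proof.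
apply: (@measurable_fun_hist _ (g_sigma_algebraType (before_reward Rw G t)) R A a0
  c p Rw G _ _ t exp_psi) => [k b /andP[k0 kt]|k b /andP[k0 kt]|h ht].
- by apply: reward_before_reward; rewrite k0 ltnW.
- by apply: perturbation_before_reward; rewrite k0 ltnW.
apply: (@measurable_exp_psi _ (g_sigma_algebraType (before_reward Rw G t))).
by move=> k; rewrite ht; exact: reward_before_reward.
Qed.

Lemma measurable_act t b :
  measurable_fun (T := g_sigma_algebraType (before_reward Rw G t)) setT
    (fun w => act t.+1 w == b).
Proof.
apply: (discretely_measurable_pred (fun h => last a0 h == b)).
exact: hist_before_reward.
Qed.

Hypothesis exp_step : forall t,
  (\int[P]_w (expR (e * psi_p p (Rw t.+1 a w / s) - m))%:E <= 1)%E.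

(* Between rounds the truncated exponential process loses at least the mass it
   carries on the event that the [(n+1)]-st pull of [a] takes place. *)
Lemma exp_psi_supermartingale n t :
  (\int[P]_w (if (pulls (H t.+1 w) a <= n)%N then exp_psi (H t.+1 w) w else 0)%:E +
   \int[P]_w (if (pulls (H t w) a == n) && (act t.+1 w == a)
              then exp_psi (H t w) w else 0)%:E <=
   \int[P]_w (if (pulls (H t w) a <= n)%N then exp_psi (H t w) w else 0)%:E)%E.
Proof.
pose f x := expR (e * psi_p p (x / s) - m).
have mf : measurable_fun setT f.
  apply: measurableT_comp => //; apply: measurable_funB => //.
  apply: measurable_funM => //; apply: (measurableT_comp (measurable_psi_p p)).
  exact: measurable_funM.
have f0 x : 0 <= f x by exact: expR_ge0.
(* The mass at round [t] splits in three: unchanged when another arm is pulled ([U1]), multiplied by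
   an independent factor of mean at most 1 ([U2]), or removed by the truncation when pull [n + 1]
   occurs ([V]). *)
pose U1 w := if (pulls (H t w) a <= n)%N && (act t.+1 w != a)
  then exp_psi (H t w) w else 0.
pose U2 w := if (pulls (H t w) a < n)%N && (act t.+1 w == a)
  then exp_psi (H t w) w else 0.
pose V w := if (pulls (H t w) a == n) && (act t.+1 w == a)
  then exp_psi (H t w) w else 0.
have e0 h w : 0 <= exp_psi h w by exact: expR_ge0.
have U1_ge0 w : 0 <= U1 w by rewrite /U1; case: ifP.
have U2_ge0 w : 0 <= U2 w by rewrite /U2; case: ifP.
have V_ge0 w : 0 <= V w by rewrite /V; case: ifP.
have mpulls (Q : pred nat) :
    measurable_fun (T := g_sigma_algebraType (before_reward Rw G t)) setT
    (fun w => Q (pulls (H t w) a)).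
  apply: (discretely_measurable_pred (fun h => Q (pulls h a))).
  exact: hist_before_reward.
have mZ := @exp_psi_before_reward t.
have mU1 : measurable_fun setT U1.
  apply: (@measurable_of_before_reward t); apply: measurable_fun_ifT => //.
  apply: measurable_and; first exact: (mpulls (fun k => k <= n)%N).
  by apply: measurable_neg; exact: measurable_act.
have mU2F : measurable_fun (T := g_sigma_algebraType (before_reward Rw G t)) setT U2.
  apply: measurable_fun_ifT => //.
  apply: measurable_and; first exact: (mpulls (fun k => k < n)%N).
  exact: measurable_act.
have mU2 := measurable_of_before_reward mU2F.
have mV : measurable_fun setT V.
  apply: (@measurable_of_before_reward t); apply: measurable_fun_ifT => //.
  apply: measurable_and; first exact: (mpulls (fun k => k == n)%N).
  exact: measurable_act.
have mfR : measurable_fun setT (fun w => f (Rw t.+1 a w)).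
  by apply: measurableT_comp => //; exact: mRw.
have -> : (\int[P]_w (if (pulls (H t.+1 w) a <= n)%N
      then exp_psi (H t.+1 w) w else 0)%:E =
    \int[P]_w (U1 w)%:E + \int[P]_w (U2 w * f (Rw t.+1 a w))%:E)%E.
  rewrite -ge0_integralD//; last 4 first.
  - by move=> w _; rewrite lee_fin.
  - exact/measurable_EFinP.
  - by move=> w _; rewrite lee_fin mulr_ge0.
  - by apply/measurable_EFinP; exact: measurable_funM.
  apply: eq_integral => w _; rewrite -EFinD; congr EFin.
  rewrite /U1 /U2 histS pulls_rcons /exp_psi pulls_rcons psi_sum_rcons.
  rewrite size_hist; case: eqVneq => [_|_]; rewrite ?andbF ?andbT.
    rewrite addn1; case: ifP => _; last by rewrite add0r mul0r.
    rewrite add0r /f -expRD; congr expR; rewrite -natr1; ring.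
  by rewrite addn0 mul0r !addr0.
have -> : (\int[P]_w (if (pulls (H t w) a <= n)%N
      then exp_psi (H t w) w else 0)%:E =
    \int[P]_w (U1 w)%:E + \int[P]_w (U2 w)%:E + \int[P]_w (V w)%:E)%E.
  rewrite -!ge0_integralD//; try exact/measurable_EFinP; try by move=> w _; rewrite lee_fin.
  - apply: eq_integral => w _; rewrite -!EFinD; congr EFin.
    rewrite /U1 /U2 /V; case: (act t.+1 w == a); rewrite /= ?andbF ?andbT.
      by rewrite add0r; case: ltngtP; rewrite ?addr0 ?add0r.
    by rewrite !addr0.
  - by move=> w _; rewrite adde_ge0// lee_fin.
  - by apply/measurable_EFinP; exact: measurable_funD.
apply: leeD => //; apply: leeD => //.
rewrite (expectation_reward mRw mG ind)//.
rewrite -[leRHS]mule1; apply: lee_wpmul2l.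
  by apply: integral_ge0 => w _; rewrite lee_fin.
exact: exp_step.
Qed.

(** The initial mass is 1. The sum controls all rounds in which pull [n + 1] could occur, without a
    union bound; the last term controls a single fixed round. *)
Lemma exp_psi_telescope n T :
  (\sum_(0 <= t < T) \int[P]_w (if (pulls (H t w) a == n) && (act t.+1 w == a)
      then exp_psi (H t w) w else 0)%:E +
   \int[P]_w (if (pulls (H T w) a <= n)%N then exp_psi (H T w) w else 0)%:E <= 1)%E.
Proof.
elim: T => [|T IH].
  rewrite big_geq// add0e.
  have -> : (fun w => (if (pulls (H 0 w) a <= n)%N then exp_psi (H 0 w) w else 0)%:E)
      = (fun=> 1%E : \bar R).
    apply/funext => w; rewrite /pulls /exp_psi /psi_sum /= big_ord0 mulr0.
    by rewrite /pulls/= mulr0 subrr expR0.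
  by rewrite (etrans (integral_cst P measurableT 1%E) (etrans (mul1e _) (probability_setT P))).
rewrite big_nat_recr//=; apply: le_trans IH; rewrite -addeA; apply: leeD => //.
by rewrite addeC; exact: exp_psi_supermartingale.
Qed.

End arm.

End telescoping.

(** * Real-valued probabilities and Markov's inequality *)

Section real_probability.
Context (R : realType) (d : measure_display) (T : measurableType d).
Variable P : probability T R.

Definition pr (E : set T) : R := fine (P E).

Lemma prE E : measurable E -> P E = (pr E)%:E.
Proof. by move=> mE; rewrite /pr fineK// fin_num_measure. Qed.

Lemma pr_ge0 E : 0 <= pr E.
Proof. by rewrite /pr fine_ge0. Qed.

Lemma pr_le E E' : measurable E -> measurable E' -> E `<=` E' -> pr E <= pr E'.
Proof.
move=> mE mE' EE'; rewrite -lee_fin -!prE//.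
by apply: le_measure; rewrite ?inE.
Qed.

Lemma pr_le1 E : measurable E -> pr E <= 1.
Proof. by move=> mE; rewrite -lee_fin -prE//; exact: probability_le1. Qed.

Lemma pr_setU_le E E' E'' : measurable E -> measurable E' -> measurable E'' ->
  E `<=` E' `|` E'' -> pr E <= pr E' + pr E''.
Proof.
move=> mE mE' mE'' EE; rewrite -lee_fin EFinD -!prE//.
apply: le_trans (measureU2 _ mE' mE''); apply: le_measure; rewrite ?inE//.
exact: measurableU.
Qed.

Lemma pr_setD E E' : measurable E -> measurable E' -> E' `<=` E ->
  pr (E `\` E') = pr E - pr E'.
Proof.
move=> mE mE' EE'; rewrite /pr measureD//; last by rewrite ltey_eq fin_num_measure.
by rewrite setIidr// fineB// fin_num_measure.
Qed.

Lemma markov_pr (E : set T) (f : T -> R) (k : R) : measurable E -> 0 < k ->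
  measurable_fun setT f -> (forall w, 0 <= f w) -> (forall w, E w -> k <= f w) ->
  ((pr E)%:E <= k^-1%:E * \int[P]_w (f w)%:E)%E.
Proof.
move=> mE k0 mf f0 Ef.
rewrite -prE// -(setIT E) -(integral_indic P measurableT mE).
rewrite -ge0_integralZl//; last 3 first.
- exact/measurable_EFinP.
- by move=> w _; rewrite lee_fin.
- by rewrite lee_fin invr_ge0 ltW.
apply: ge0_le_integral => //.
- by apply/measurable_EFinP; exact: measurable_indic.
- by apply/measurable_EFinP; exact: measurable_funM.
move=> w _; rewrite -EFinM lee_fin indicE.
have [/set_mem Ew|_] := boolP (w \in E); last first.
  by rewrite mulr_ge0// invr_ge0 ltW.
by rewrite mulrC ler_pdivlMr// mul1r Ef.
Qed.

Lemma pr_indicator (b : T -> bool) : measurable_fun setT b ->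
  (\int[P]_w (if b w then 1 else 0 : R)%:E = (pr [set w | b w])%:E)%E.
Proof.
move=> mb; have mE := measurable_bool_set mb.
rewrite -prE// -[in RHS](setIT [set w | b w]) -integral_indic//.
apply: eq_integral => w _; rewrite indicE; congr EFin.
by case: ifPn => bw; [rewrite mem_set|rewrite memNset//; exact/negP].
Qed.

End real_probability.

(** * Exponential deviation bounds for the estimator *)

Section concentration.
Context (R : realType) (c p nu : R) (A : finType) (a0 : A).
Context (d : measure_display) (Omega : measurableType d) (P : probability Omega R).
Variables (Rw G : nat -> A -> Omega -> R) (r : A -> R).
Hypotheses (c0 : 0 < c) (p12 : 1 < p <= 2).
Hypothesis mRw : forall t a, (0 < t)%N -> measurable_fun setT (Rw t a).
Hypothesis mG : forall t a, (0 < t)%N -> measurable_fun setT (G t a).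
Hypothesis ERw : forall t a, (0 < t)%N ->
  (\int[P]_w (Rw t a w)%:E = (r a)%:E)%E.
Hypothesis Epow : forall t a, (0 < t)%N ->
  (\int[P]_w (`|Rw t a w| `^ p)%:E <= nu%:E)%E.
Hypothesis ind : mutually_independent P
  (fun i : (nat * A) + (nat * A) =>
     match i with inl (t, _) | inr (t, _) => (0 < t)%N end)
  (fun i => match i with
            | inl (t, a) => Rw t a
            | inr (t, a) => G t a end).

Notation H := (hist c p a0 Rw G).
Notation act := (act c p a0 Rw G).

Definition scale (n : nat) : R := c / n%:R `^ (1 - p^-1).

Definition arm_est (a : A) (t : nat) (w : Omega) : R :=
  ape2_est c p (fun k b => Rw k b w) (H t w) a.

Lemma scale_gt0 n : (0 < n)%N -> 0 < scale n.
Proof. by move=> n0; rewrite divr_gt0// powR_gt0// ltr0n. Qed.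

Lemma measurable_hist_pred t (Q : seq A -> bool) :
  measurable_fun setT (fun w => Q (H t w)).
Proof. by apply: discretely_measurable_pred; exact: hist_measurable. Qed.

Lemma measurable_act_eq t a : measurable_fun setT (fun w => act t.+1 w == a).
Proof. exact: (measurable_hist_pred t.+1 (fun h => last a0 h == a)). Qed.

Lemma measurable_arm_est a t : measurable_fun setT (arm_est a t).
Proof.
apply: (@measurable_fun_hist _ Omega R A a0 c p Rw G _ _ t
  (fun h w => ape2_est c p (fun k b => Rw k b w) h a)) => [k b /andP[k0 _]|k b /andP[k0 _]|h ht].
- exact: mRw.
- exact: mG.
- by apply: measurable_est => k /andP[k0 _]; exact: mRw.
Qed.

(** Pull number [n + 1] happens at most once. This is the telescoped inequality for the constant
    process, with [e = m = 0]. *)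
Lemma sum_pr_pull a n T :
  \sum_(0 <= t < T)
    pr P [set w | (pulls (H t w) a == n) && (act t.+1 w == a)] <= 1.
Proof.
have step t : (\int[P]_w (expR (0 * psi_p p (Rw t.+1 a w / 1) - 0))%:E <= 1)%E.
  under eq_integral do rewrite mul0r subrr expR0.
  by rewrite (etrans (integral_cst P measurableT 1%E) (etrans (mul1e _) (probability_setT P))).
rewrite -lee_fin -sumEFin.
apply: le_trans (exp_psi_telescope c a0 mRw mG ind step n T).
rewrite -[leLHS]adde0; apply: leeD; last first.
  by apply: integral_ge0 => w _; rewrite lee_fin; case: ifP => // _; exact: expR_ge0.
apply: lee_sum => t _.
rewrite -pr_indicator; last first.
  apply: measurable_and; last exact: measurable_act_eq.
  exact: (measurable_hist_pred t (fun h => pulls h a == n)).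
rewrite le_eqVlt; apply/orP; left; apply/eqP; apply: eq_integral => w _.
by rewrite /exp_psi !mul0r subrr expR0.
Qed.

Section deviation.
Variables (a : A) (e x : R) (n : nat).
Hypotheses (e1 : e = 1 \/ e = -1) (n0 : (0 < n)%N).

Let M := b_p p * `|nu| / c `^ p.
Let dev t w := x <= e * (arm_est a t w - r a) / scale n.

Let mdev t : measurable_fun setT (dev t).
Proof.
apply: measurable_fun_ler => //; apply: measurable_funM => //.
apply: measurable_funM => //; apply: measurable_funB => //.
exact: measurable_arm_est.
Qed.

(** Since [s = scale n * n] and [s^p = c^p n], after [n] pulls the compensator is
    [m n = e r_a / scale n + M], with [M] free of [n]; the process is then [exp] of the normalised
    deviation minus [M]. *)
Let s := c * n%:R `^ p^-1.
Let m := e * r a / s + b_p p * `|nu| / s `^ p.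

Let s0 : 0 < s.
Proof. by rewrite mulr_gt0// powR_gt0// ltr0n. Qed.

Let step t : (\int[P]_w (expR (e * psi_p p (Rw t.+1 a w / s) - m))%:E <= 1)%E.
Proof.
have mexp : measurable_fun setT (fun w => expR (e * psi_p p (Rw t.+1 a w / s))).
  apply: measurableT_comp => //; apply: measurable_funM => //.
  apply: (measurableT_comp (measurable_psi_p p)).
  by apply: measurable_funM => //; exact: mRw.
under eq_integral do rewrite expRD mulrC EFinM.
rewrite ge0_integralZl ?lee_fin ?expR_ge0//; last exact/measurable_EFinP.
apply: (@le_trans _ _ ((expR (- m))%:E * (expR m)%:E)%E); last first.
  by rewrite -EFinM -expRD addNr expR0.
apply: lee_wpmul2l; first by rewrite lee_fin expR_ge0.
exact: (exp_moment_psi p12 mRw ERw Epow).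
Qed.

Let exp_psi_dev t w : pulls (H t w) a = n -> dev t w ->
  expR (x - M) <= exp_psi p Rw a s e m (H t w) w.
Proof.
move=> hn; rewrite /dev ler_pdivlMr ?scale_gt0// => hx.
rewrite /exp_psi ler_expR hn; set S := psi_sum _ _ _ _ _ _.
have b0 := scale_gt0 n0.
have nR : 0 < n%:R :> R by rewrite ltr0n.
have p0 : p != 0 by case/andP: p12; lra.
have estE : arm_est a t w = scale n * S.
  by rewrite /arm_est /ape2_est /scale hn /S /psi_sum.
have sE : s = scale n * n%:R.
  have nE : n%:R = n%:R `^ (1 - p^-1) * n%:R `^ p^-1 :> R.
    by rewrite -powRD_gt0// subrK powRr1// ltW.
  by rewrite /s /scale [X in _ = _ * X]nE mulrA divfK// gt_eqF// powR_gt0.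
have mn : m * n%:R = e * r a / scale n + M.
  rewrite /m mulrDl; congr (_ + _).
    by rewrite sE; field; rewrite !gt_eqF.
  rewrite /M /s powRM ?powR_ge0 ?(ltW c0)// -powRrM mulVf// powRr1 ?(ltW nR)//.
  by field; rewrite !gt_eqF// powR_gt0.
rewrite estE in hx.
have -> : e * S - m * n%:R = e * (scale n * S - r a) / scale n - M.
  by rewrite mn; field; rewrite gt_eqF.
by rewrite lerD2r ler_pdivlMr.
Qed.

Let mexp t : measurable_fun setT (fun w => exp_psi p Rw a s e m (H t w) w).
Proof.
have h := @exp_psi_before_reward R c p A a0 d Omega Rw G a s e m t.
exact: (measurable_of_before_reward mRw mG h).
Qed.

Let markov_dev t (Q : Omega -> bool) : measurable_fun setT Q ->
  (forall w, Q w -> pulls (H t w) a = n) ->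
  ((pr P [set w | Q w && dev t w])%:E <=
   (expR (M - x))%:E * \int[P]_w (if Q w then exp_psi p Rw a s e m (H t w) w else 0)%:E)%E.
Proof.
move=> mQ Qn; rewrite -opprB expRN; apply: markov_pr.
- by apply: measurable_bool_set; apply: measurable_and.
- exact: expR_gt0.
- by apply: measurable_fun_ifT.
- by move=> w; case: ifP => // _; exact: expR_ge0.
- by move=> w /= /andP[Qw dw]; rewrite Qw; apply: exp_psi_dev => //; exact: Qn.
Qed.

Let telescope T := exp_psi_telescope c a0 mRw mG ind step n T.

(** From the remainder term of the telescoped inequality: a bound at one round in which [a] need not
    be pulled. It handles the values of [z] beyond the last level. *)
Lemma deviation_le T :
  pr P [set w | (pulls (H T w) a == n) &&
                (x <= e * (arm_est a T w - r a) / scale n)] <= expR (M - x).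
Proof.
have mQ := measurable_hist_pred T (fun h => pulls h a == n).
have /(markov_dev mQ) h w : pulls (H T w) a == n -> pulls (H T w) a = n by move/eqP.
rewrite -lee_fin; apply: le_trans h _.
rewrite -[leRHS]mule1; apply: lee_wpmul2l; first by rewrite lee_fin expR_ge0.
apply: le_trans (telescope T); rewrite -[leLHS]add0e; apply: leeD.
  by apply: sume_ge0 => t _; apply: integral_ge0 => w _; rewrite lee_fin;
    case: ifP => // _; exact: expR_ge0.
have mexpT := mexp T.
have e0 w : 0 <= exp_psi p Rw a s e m (H T w) w by exact: expR_ge0.
apply: ge0_le_integral => //.
- by move=> w _; rewrite lee_fin; case: ifP.
- by apply/measurable_EFinP; exact: measurable_fun_ifT.
- apply/measurable_EFinP; apply: measurable_fun_ifT => //.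
  exact: (measurable_hist_pred T (fun h => (pulls h a <= n)%N)).
- by move=> w _; rewrite lee_fin; case: eqP => [->|_]; [rewrite leqnn|case: ifP].
Qed.

(** Restricting to the rounds that pull [a] from [n] pulls lets a single exponential pay for all [T]
    rounds. *)
Lemma sum_deviation_le T :
  \sum_(0 <= t < T)
    pr P [set w | ((pulls (H t w) a == n) && (act t.+1 w == a)) &&
                (x <= e * (arm_est a t w - r a) / scale n)] <= expR (M - x).
Proof.
rewrite -lee_fin -sumEFin -[leRHS]mule1.
apply: (@le_trans _ _ (\sum_(0 <= t < T) (expR (M - x))%:E *
   \int[P]_w (if (pulls (H t w) a == n) && (act t.+1 w == a)
              then exp_psi p Rw a s e m (H t w) w else 0)%:E)%E).
  apply: lee_sum => t _.
  have mQ : measurable_fun setT (fun w => (pulls (H t w) a == n) && (act t.+1 w == a)).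
    apply: measurable_and; last exact: measurable_act_eq.
    exact: (measurable_hist_pred t (fun h => pulls h a == n)).
  by apply: markov_dev => // w /andP[/eqP].
have I0 t : (0 <= \int[P]_w (if (pulls (H t w) a == n) && (act t.+1 w == a)
              then exp_psi p Rw a s e m (H t w) w else 0)%:E)%E.
  by apply: integral_ge0 => w _; rewrite lee_fin; case: ifP => // _; exact: expR_ge0.
rewrite -ge0_sume_distrr//; apply: lee_wpmul2l; first by rewrite lee_fin expR_ge0.
apply: le_trans (telescope T); rewrite leeDl//.
by apply: integral_ge0 => w _; rewrite lee_fin; case: ifP => // _; exact: expR_ge0.
Qed.

End deviation.

End concentration.

(** * The optimal arm *)

Lemma sum_by_parts (R : pzRingType) (u f : nat -> R) N :
  \sum_(i < N.+1) u i * (f i - f i.+1) =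
  u 0 * f 0 + \sum_(i < N) (u i.+1 - u i) * f i.+1 - u N * f N.+1.
Proof.
elim: N => [|N IH]; first by rewrite big_ord_recr !big_ord0/= addr0 add0r mulrBr.
rewrite big_ord_recr/= IH [in RHS]big_ord_recr/= mulrBr mulrBl !addrA.
congr (_ - _); rewrite -!addrA; congr (_ + (_ + _)).
by rewrite [RHS]addrC.
Qed.

Section optimal_arm.
Context (R : realType) (c p nu : R) (F : R -> R) (A : finType) (a0 : A).
Context (d : measure_display) (Omega : measurableType d) (P : probability Omega R).
Variables (Rw G : nat -> A -> Omega -> R) (r : A -> R).
Hypotheses (c0 : 0 < c) (p12 : 1 < p <= 2) (PF : perturbation_assumption F).
Hypothesis mRw : forall t a, (0 < t)%N -> measurable_fun setT (Rw t a).
Hypothesis mG : forall t a, (0 < t)%N -> measurable_fun setT (G t a).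
Hypothesis ERw : forall t a, (0 < t)%N ->
  (\int[P]_w (Rw t a w)%:E = (r a)%:E)%E.
Hypothesis Epow : forall t a, (0 < t)%N ->
  (\int[P]_w (`|Rw t a w| `^ p)%:E <= nu%:E)%E.
Hypothesis Gcdf : forall t a g, (0 < t)%N ->
  P [set w | G t a w < g] = (F g)%:E.
Hypothesis ind : mutually_independent P
  (fun i : (nat * A) + (nat * A) =>
     match i with inl (t, _) | inr (t, _) => (0 < t)%N end)
  (fun i => match i with
            | inl (t, a) => Rw t a
            | inr (t, a) => G t a end).

Notation H := (hist c p a0 Rw G).
Notation act := (act c p a0 Rw G).
Notation est := (arm_est c p a0 Rw G).
Notation scale := (scale c p).
Let M := b_p p * `|nu| / c `^ p.

Definition arm_index (b : A) (t : nat) (w : Omega) : R :=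
  est b t w + scale (pulls (H t w) b) * G t.+1 b w.

Lemma act_max t b w : (#|A| <= t)%N -> arm_index b t w <= arm_index (act t.+1 w) t w.
Proof.
move=> At; rewrite /act /ape2_action /= last_rcons /ape2_choose ltnNge At/=.
by case: Order.TotalTheory.arg_maxP => // i _; exact.
Qed.

Lemma measurable_arm_index b t : measurable_fun setT (arm_index b t).
Proof.
apply: measurable_funD; first exact: measurable_arm_est.
apply: measurable_funM; last exact: mG.
apply: (@measurable_fun_discrete_comp _ Omega _ R (seq A) (H t)
  (fun h _ => scale (pulls h b))) => //.
exact: hist_measurable.
Qed.

Variables (astar : A) (y : R).

Lemma hist_before_perturbation t : discretely_measurable
  (T := g_sigma_algebraType (before_perturbation Rw G t astar)) (H t).
Proof.
apply: discretely_measurable_hist => k b /andP[k0 kt].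
  by apply: reward_before_perturbation; rewrite k0 ltnW.
apply: perturbation_before_perturbation; first by rewrite k0 leqW.
by apply/eqP => -[kE _]; move: kt; rewrite kE ltnn.
Qed.

Lemma est_before_perturbation b t :
  measurable_fun (T := g_sigma_algebraType (before_perturbation Rw G t astar)) setT
    (est b t).
Proof.
set Gt := g_sigma_algebraType _.
apply: (@measurable_fun_hist _ Gt R A a0 c p Rw G _ _ t
    (fun h w => ape2_est c p (fun k b => Rw k b w) h b)) =>
  [k e /andP[k0 kt]|k e /andP[k0 kt]|h ht].
- by apply: reward_before_perturbation; rewrite k0 ltnW.
- apply: perturbation_before_perturbation; first by rewrite k0 leqW.
  by apply/eqP => -[kE _]; move: kt; rewrite kE ltnn.
- apply: (@measurable_est _ Gt) => k; rewrite ht.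
  exact: reward_before_perturbation.
Qed.

(** The indices of the other arms involve [G_{t+1,b}] only for [b] distinct from [astar], and these
    remain after [G_{t+1,astar}] has been removed. *)
Lemma others_before_perturbation t :
  measurable_fun (T := g_sigma_algebraType (before_perturbation Rw G t astar)) setT
    (fun w => [forall (b | b != astar), arm_index b t w <= y]).
Proof.
set Gt := g_sigma_algebraType _.
have -> : (fun w => [forall (b | b != astar), arm_index b t w <= y]) =
    (fun w => \big[andb/true]_(b : A) ((b == astar) || (arm_index b t w <= y))).
  apply/funext => w; rewrite big_andE; apply: eq_forallb => b.
  by rewrite implybE negbK.
elim: (index_enum A) => [|b s IH].
  by under eq_fun do rewrite big_nil; exact: measurable_cst.
under eq_fun do rewrite big_cons.
apply: measurable_and => //; have [->|bs] := eqVneq b astar.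
  exact: measurable_cst.
apply: measurable_fun_ler => //; apply: measurable_funD.
  exact: est_before_perturbation.
apply: measurable_funM.
  apply: (@measurable_fun_discrete_comp _ Gt _ R (seq A) (H t)
    (fun h _ => scale (pulls h b))) => //.
  exact: hist_before_perturbation.
apply: perturbation_before_perturbation; first by rewrite ltnSn.
by apply/eqP => -[bE]; rewrite bE eqxx in bs.
Qed.

Lemma pulls_before_perturbation t n :
  measurable_fun (T := g_sigma_algebraType (before_perturbation Rw G t astar)) setT
    (fun w => pulls (H t w) astar == n).
Proof.
apply: (discretely_measurable_pred (fun h => pulls h astar == n)).
exact: hist_before_perturbation.
Qed.

Lemma measurable_of_before_perturbation t d' (T' : measurableType d')
    (U : Omega -> T') :
  @measurable_fun _ _ (g_sigma_algebraType (before_perturbation Rw G t astar)) T' setT U ->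
  measurable_fun setT U.
Proof.
move=> mU _ B mB; apply: (sigma_cylinders_measurable _ (mU measurableT B mB)).
move=> i /mem_rem /(allP (round_indices_pos _ t)).
by case: i => -[s b]; [exact: mRw|exact: mG].
Qed.

Variable n : nat.
Hypothesis n0 : (0 < n)%N.

Let z t w := (y - est astar t w) / scale n.
Let V t w := [forall (b | b != astar), arm_index b t w <= y] &&
  (pulls (H t w) astar == n).

Let mz t : measurable_fun (T := g_sigma_algebraType (before_perturbation Rw G t astar))
  setT (z t).
Proof.
apply: measurable_funM => //; apply: measurable_funB => //.
exact: est_before_perturbation.
Qed.

Let mzO t : measurable_fun setT (z t).
Proof. exact: measurable_of_before_perturbation (@mz t). Qed.

Let mV t : measurable_fun (T := g_sigma_algebraType (before_perturbation Rw G t astar))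
  setT (V t).
Proof.
by apply: measurable_and;
  [exact: others_before_perturbation|exact: pulls_before_perturbation].
Qed.

Let mVO t : measurable_fun setT (V t).
Proof. exact: measurable_of_before_perturbation (@mV t). Qed.

(* If [G] exceeds [u > z], the optimal arm is pulled; by independence this has
   conditional probability [1 - F u], against at most [F u] for [G <= z]. *)
Lemma pr_lost_round_le t (Q : R -> bool) (u : R) : (#|A| <= t)%N ->
  measurable_fun setT Q -> (forall x, Q x -> x < u) ->
  pr P [set w | (V t w && (G t.+1 astar w <= z t w)) && Q (z t w)] <=
  odds F u *
    pr P [set w | ((pulls (H t w) astar == n) && (act t.+1 w == astar)) && Q (z t w)].
Proof.
move=> At mQ Qu.
have mE : measurable_fun (T := g_sigma_algebraType (before_perturbation Rw G t astar))
    setT (fun w => V t w && Q (z t w)).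
  by apply: measurable_and => //; apply: measurableT_comp.
pose E := [set w | V t w && Q (z t w)].
have sE : <<s before_perturbation Rw G t astar >> E.
  by have := measurable_bool_set mE.
have mEO : measurable E.
  exact: measurable_bool_set (measurable_of_before_perturbation mE).
have mGt := mG astar (ltn0Sn t).
have mGu : measurable (G t.+1 astar @^-1` `]-oo, u[).
  by rewrite -[X in measurable X]setTI; exact: mGt.
have GE : G t.+1 astar @^-1` `]-oo, u[ = [set w | G t.+1 astar w < u].
  by apply/seteqP; split => w /=; rewrite in_itv.
have PG : P (G t.+1 astar @^-1` `]-oo, u[) = (F u)%:E by rewrite GE Gcdf.
have F1 : F u < 1 by case: PF => [_ [_ [_ [_ [_ []]]]]].
have hlt : pr P (E `&` G t.+1 astar @^-1` `]-oo, u[) = pr P E * F u.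
  by rewrite /pr (indep_perturbation mRw mG ind)// PG fineM ?fin_num_measure.
have hge : pr P (E `\` (E `&` G t.+1 astar @^-1` `]-oo, u[)) = pr P E * (1 - F u).
  rewrite pr_setD//; last exact: measurableI.
  by rewrite hlt mulrBr mulr1.
have mQz : measurable_fun setT (fun w => Q (z t w)).
  exact: measurableT_comp mQ (@mzO t).
have mact : measurable_fun setT (fun w =>
    ((pulls (H t w) astar == n) && (act t.+1 w == astar)) && Q (z t w)).
  apply: measurable_and => //; apply: measurable_and.
    exact: measurable_of_before_perturbation (@pulls_before_perturbation t n).
  exact: measurable_act_eq.
have le1 : pr P [set w | (V t w && (G t.+1 astar w <= z t w)) && Q (z t w)] <=
    pr P E * F u.
  rewrite -hlt; apply: pr_le.
  - apply: measurable_bool_set; apply: measurable_and => //.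
    by apply: measurable_and => //; exact: measurable_fun_ler.
  - exact: measurableI.
  - move=> w /= /andP[/andP[Vw Gz] Qz]; split; first by rewrite /E/= Vw.
    by rewrite in_itv/=; apply: le_lt_trans Gz (Qu _ Qz).
have le2 : pr P E * (1 - F u) <= pr P [set w |
    ((pulls (H t w) astar == n) && (act t.+1 w == astar)) && Q (z t w)].
  rewrite -hge; apply: pr_le.
  - by apply: measurableD => //; exact: measurableI.
  - exact: measurable_bool_set.
  move=> w [/= /andP[/andP[Vw nw] Qz]].
  rewrite nw Qz andbT/= => nG.
  have uG : u <= G t.+1 astar w.
    rewrite leNgt; apply/negP => Gu; apply: nG.
    by split; [rewrite /E /= /V Vw nw Qz|rewrite /= in_itv].
  apply/negPn/negP => nact.
  have sc := @scale_gt0 R c p c0 n n0.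
  have := act_max astar w At.
  move/forallP: Vw => /(_ (act t.+1 w)); rewrite nact/= => le_y.
  move=> /le_trans/(_ le_y); rewrite /arm_index (eqP nw) leNgt => /negP; apply.
  have zu : z t w < G t.+1 astar w by apply: lt_le_trans (Qu _ Qz) uG.
  by move: zu; rewrite /z ltr_pdivrMr// ltrBlDl mulrC.
apply: le_trans le1 _; rewrite /odds mulrAC ler_pdivlMr ?subr_gt0//.
rewrite [leRHS]mulrC -mulrA [F u * _]mulrC mulrA; apply: ler_wpM2r => //.
exact: cdf_ge0.
Qed.

Let D := (r astar - y) / scale n.
(** Slab [i] runs from [level (i - 1)], included, to [level i], excluded, and slab 0 is everything
    below [- D / 2]. The odds are taken at the upper end; [above i] is the lower-end condition,
    hence its shift of index. *)
Let level (i : nat) : R := if i is i'.+1 then i'%:R else - D / 2.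
Let above (i : nat) (x : R) := if i is i'.+1 then level i' <= x else true.

Let mabove i : measurable_fun setT (above i).
Proof. by case: i => [|i] /=; [exact: measurable_cst|exact: measurable_fun_ler]. Qed.

Hypothesis ygap : y < r astar.

Let D_gt0 : 0 < D.
Proof. by rewrite divr_gt0 ?subr_gt0//; exact: scale_gt0. Qed.

Let level_le i : level i <= level i.+1.
Proof.
case: i => [|i] /=; last by rewrite ler_nat.
by have := D_gt0; lra.
Qed.

Let above_le i x : above i.+1 x -> above i x.
Proof. by case: i => //= i; apply: le_trans; exact: level_le. Qed.

Let zdev t w v : (v <= z t w) = (v + D <= -1 * (est astar t w - r astar) / scale n).
Proof.
have sc := @scale_gt0 R c p c0 n n0.
rewrite -lerBrDr; congr (_ <= _); rewrite /z /D.
by field; rewrite gt_eqF.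
Qed.

(* Lost rounds are split along [level 0 < level 1 < ...] according to the value of
   [z], and the resulting sum is bounded by parts from the tails of [z]. The last
   level is [T], beyond which the [T] rounds have negligible total probability. *)
Lemma sum_pr_lost_rounds_le (CW : R) T : 0 <= CW ->
  (forall N : nat,
    \sum_(k < N) expR (- k%:R) * (odds F k.+1%:R - odds F k%:R) <= CW) ->
  \sum_(0 <= t < T | (#|A| <= t)%N)
    pr P [set w | V t w && (G t.+1 astar w <= z t w)] <=
  odds F (- D / 2) + (2 + CW) * expR (M - D / 2).
Proof.
move=> CW0 HCW.
pose pulled t w := (pulls (H t w) astar == n) && (act t.+1 w == astar).
have mpulled t : measurable_fun setT (pulled t).
  apply: measurable_and; last exact: measurable_act_eq.
  exact: measurable_of_before_perturbation (@pulls_before_perturbation t n).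
have mab i t : measurable_fun setT (fun w => above i (z t w)).
  exact: measurableT_comp (@mabove i) (@mzO t).
pose lost t w := V t w && (G t.+1 astar w <= z t w).
have mlost t : measurable_fun setT (lost t).
  by apply: measurable_and => //; apply: measurable_fun_ler => //; exact: mG.
pose Q i x := above i x && (x < level i).
have mQ i : measurable_fun setT (Q i).
  by apply: measurable_and => //; exact: measurable_fun_ltr.
have mQz i t : measurable_fun setT (fun w => Q i (z t w)).
  exact: measurableT_comp (mQ i) (@mzO t).
have cover t N : pr P [set w | lost t w] <=
    \sum_(i < N) pr P [set w | lost t w && Q i (z t w)] +
    pr P [set w | lost t w && above N (z t w)].
  elim: N => [|N IH].
    rewrite big_ord0 add0r; apply: pr_le.
    + exact: measurable_bool_set.
    + by apply: measurable_bool_set; exact: measurable_and.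
    + by move=> w /= ->.
  apply: le_trans IH _; rewrite big_ord_recr/= -addrA lerD2l.
  apply: pr_setU_le; try by apply: measurable_bool_set; exact: measurable_and.
    by apply: measurable_bool_set; apply: measurable_and => //; exact: (mab N.+1).
  move=> w /= /andP[-> aN]; rewrite /Q aN /=.
  by have [h|h] := ltP (z t w) (level N); [left|right].
(* Tail sums of [z] over the rounds in which [astar] gets pull [n + 1]: [f 0 <= 1],
   [f 1 <= e^(M - D/2)] and [f (k + 2) <= e^(M - D - k)]. The slabs are their differences. *)
pose f i := \sum_(0 <= t < T) pr P [set w | pulled t w && above i (z t w)].
have fB i : \sum_(0 <= t < T) pr P [set w | pulled t w && Q i (z t w)] =
    f i - f i.+1.
  rewrite /f -sumrB; apply: eq_bigr => t _; rewrite -pr_setD.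
  - congr pr; apply/seteqP; split => w /=.
      by move=> /andP[-> /andP[-> h]]; split => //=; apply/negP; rewrite -ltNge.
    move=> [/andP[-> aw] /negP]; rewrite /Q aw /= -ltNge //.
  - by apply: measurable_bool_set; exact: measurable_and.
  - by apply: measurable_bool_set; apply: measurable_and => //; exact: (mab i.+1).
  - by move=> w /= /andP[-> h]; apply: (@above_le i).
have dev v : \sum_(0 <= t < T) pr P [set w | pulled t w && (v <= z t w)] <=
    expR (M - D - v).
  have := sum_deviation_le a0 c0 p12 mRw mG ERw Epow ind astar (v + D) (or_intror erefl) n0 T.
  have -> : M - D - v = M - (v + D) by ring.
  apply: le_trans; rewrite le_eqVlt; apply/orP; left; apply/eqP.
  apply: eq_bigr => t _; congr pr; apply/funext => w /=.
  by rewrite zdev.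
have f0_ge0 : 0 <= f 0.
  by apply: sumr_ge0 => t _; exact: pr_ge0.
have f0 : f 0 <= 1.
  apply: le_trans (sum_pr_pull c p a0 mRw mG ind astar n T).
  rewrite le_eqVlt; apply/orP; left; apply/eqP; apply: eq_bigr => t _.
  by congr pr; apply/funext => w /=; rewrite andbT.
pose E := expR (M - D / 2).
have ED : expR (M - D) <= E by rewrite ler_expR; have := D_gt0; lra.
have E0 : 0 <= E by exact: expR_ge0.
have f1 : f 1 <= E.
  have := dev (- D / 2); rewrite (_ : M - D - - D / 2 = M - D / 2)//.
  by field.
have f2 k : f k.+2 <= expR (M - D) * expR (- k%:R).
  by rewrite -expRD; exact: (dev k%:R).
(* A lost round need not pull [astar], so this is the single-round bound. The [T] rounds together
   cost at most [E], because [T <= e^T]. *)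
have rest t : pr P [set w | lost t w && above T.+2 (z t w)] <= E * expR (- T%:R).
  apply: (@le_trans _ _ (pr P [set w | (pulls (H t w) astar == n) && (T%:R <= z t w)])).
    apply: pr_le.
    - by apply: measurable_bool_set; apply: measurable_and => //; exact: (mab T.+2).
    - apply: measurable_bool_set; apply: measurable_and; last exact: measurable_fun_ler.
      exact: measurable_of_before_perturbation (@pulls_before_perturbation t n).
    - by move=> w /= /andP[/andP[/andP[_ ->] _] ->].
  have := deviation_le a0 c0 p12 mRw mG ERw Epow ind astar (T%:R + D) (or_intror erefl) n0 t.
  have -> : [set w | (pulls (H t w) astar == n) && (T%:R <= z t w)] =
    [set w | (pulls (H t w) astar == n) &&
       (T%:R + D <= -1 * (est astar t w - r astar) / scale n)].
    by apply/funext => w /=; rewrite zdev.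
  rewrite -/M => h; apply: le_trans h _; rewrite -expRD ler_expR.
  by have := D_gt0; lra.
have odds_le' i : odds F (level i) <= odds F (level i.+1).
  exact: (odds_le PF).
have o0 x : 0 <= odds F x by exact: (odds_ge0 PF).
have main : \sum_(0 <= t < T | (#|A| <= t)%N) pr P [set w | lost t w] <=
    \sum_(i < T.+2) odds F (level i) * (f i - f i.+1) + E.
  apply: (@le_trans _ _ (\sum_(0 <= t < T)
    (\sum_(i < T.+2) odds F (level i) * pr P [set w | pulled t w && Q i (z t w)]
      + E * expR (- T%:R)))).
    rewrite big_mkcond/=; apply: ler_sum => t _; case: ifP => [At|_]; last first.
      rewrite addr_ge0 ?mulr_ge0 ?expR_ge0//; apply: sumr_ge0 => i _.
      by rewrite mulr_ge0 ?pr_ge0.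
    apply: le_trans (cover t T.+2) _; apply: lerD => //.
    apply: ler_sum => i _; apply: pr_lost_round_le => //.
    by move=> x /andP[].
  rewrite big_split/= exchange_big/=; apply: lerD.
    apply: ler_sum => i _; rewrite -mulr_sumr fB//.
  rewrite sumr_const_nat subn0 -mulrnAr -[leRHS]mulr1; apply: ler_wpM2l => //.
  rewrite -mulr_natl expRN ler_pdivrMr ?expR_gt0// mul1r.
  by apply: le_trans (expR_ge1Dx _); rewrite lerDr.
(* The differences move from the tails to the odds. The factor [2 + CW] collects one [E] beyond the
   last level, one for the increment up to level 0 of the integers (odds at most 1 there), and [CW]
   from the weighted increments. *)
apply: le_trans main _; rewrite (sum_by_parts (fun i => odds F (level i)) f) big_ord_recl/=.
have fge0 i : 0 <= f i by apply: sumr_ge0 => t _; exact: pr_ge0.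
have h0 : odds F (- D / 2) * f 0 <= odds F (- D / 2).
  by rewrite -[leRHS]mulr1; apply: ler_wpM2l.
have h1 : (odds F 0 - odds F (- D / 2)) * f 1 <= E.
  have := odds_le' 0; have := o0 (- D / 2); have := odds0_le1 PF => /=.
  move=> o1 o2 o3; rewrite -[leRHS]mul1r; apply: ler_pM => //; lra.
have h2 : \sum_(i < T) (odds F (level i.+2) - odds F (level i.+1)) * f i.+2 <= CW * E.
  apply: (@le_trans _ _ (expR (M - D) *
      \sum_(k < T) expR (- k%:R) * (odds F k.+1%:R - odds F k%:R))).
    rewrite mulr_sumr; apply: ler_sum => i _.
    rewrite mulrA [leRHS]mulrC; apply: ler_wpM2l => //.
    by rewrite subr_ge0; exact: odds_le'.
  rewrite mulrC; apply: ler_pM => //.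
  by apply: sumr_ge0 => i _; rewrite mulr_ge0 ?expR_ge0// subr_ge0; exact: (odds_le' i.+1).
have h3 : 0 <= odds F (level T.+1) * f T.+2 by rewrite mulr_ge0.
move: h2 h3; rewrite /= => h2 h3.
rewrite /bump/=; set S1 := \sum_(i < T) _.
have -> : S1 = \sum_(i < T) (odds F (level i.+2) - odds F (level i.+1)) * f i.+2.
  by apply: eq_bigr => i _; rewrite add1n.
rewrite /= -/E; lra.
Qed.

End optimal_arm.

(** * Suboptimal arms *)

(** With [q = p / (p - 1)] one has [1 / q = 1 - 1 / p], the exponent in [scale]; this writes the
    normalised gap after [n] pulls as [(n / n0)^(1/q)]. *)
Lemma powR_quotient_root (R : realType) (p k x : R) : 1 < p -> 0 < k -> 0 <= x ->
  (x / k `^ (p / (p - 1))) `^ (p / (p - 1))^-1 = x `^ (1 - p^-1) / k.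
Proof.
move=> p1 k0 x0; have qE : (p / (p - 1))^-1 = 1 - p^-1 by field; lra.
rewrite qE -powRN powRM ?powR_ge0// -powRrM.
rewrite (_ : - (p / (p - 1)) * (1 - p^-1) = -1); last by field; lra.
by rewrite powR_inv1// ltW.
Qed.

Lemma natr_ge_ceil (R : realType) (x : R) : 0 <= x ->
  exists N : nat, x <= N%:R <= x + 1.
Proof.
move=> x0; exists (Num.truncn x).+1.
have /andP[h1 h2] := truncn_itv x0.
by rewrite (ltW h2)/= -natr1 lerD2r.
Qed.

Lemma sum_ltn_le (R : realType) (N1 N : nat) :
  \sum_(1 <= n < N) (n < N1)%:R <= N1%:R :> R.
Proof.
suff h : \sum_(1 <= n < N) (n < N1)%:R <= (minn N N1)%:R :> R.
  by apply: le_trans h _; rewrite ler_nat geq_minr.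
elim: N => [|N IH]; first by rewrite big_geq.
case: N IH => [|N] IH; first by rewrite big_geq.
rewrite big_nat_recr//=; apply: le_trans (lerD IH (lexx _)) _.
rewrite -natrD ler_nat; case h : (N.+1 < N1)%N.
  by rewrite addn1 (minn_idPl (ltnW h)) (minn_idPl h).
by rewrite addn0 leq_min geq_minr andbT (leq_trans (geq_minl _ _)).
Qed.

(** * Pull counts and the round-robin phase *)

Section pulls_history.
Context (R : realType) (c p : R) (A : finType) (a0 : A).
Context (Omega : Type) (Rw G : nat -> A -> Omega -> R).

Let hist t w := ape2_hist a0 c p (fun k b => Rw k b w) (fun k b => G k b w) t.

Lemma hist_initial t w : (t <= #|A|)%N -> hist t w = take t (enum A).
Proof.
elim: t => [|t IH] tA; first by rewrite take0.
rewrite /hist /= -/(hist t w) IH ?(ltnW tA)// /ape2_choose tA /=.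
by rewrite -take_nth// -cardE.
Qed.

Lemma pulls_gt0 t w a : (#|A| <= t)%N -> (0 < pulls (hist t w) a)%N.
Proof.
elim: t => [|t IH].
  by rewrite leqn0 => /eqP /card0_eq /(_ a).
rewrite leq_eqVlt => /predU1P[At|At]; last first.
  by rewrite /hist /= -/(hist t w) pulls_rcons addn_gt0 IH.
rewrite hist_initial ?At// -At take_oversize; last by rewrite cardE.
by rewrite /pulls -has_count has_pred1 mem_enum.
Qed.

Lemma pulls_le_round t w a : (pulls (hist t w) a <= t)%N.
Proof. by rewrite -[leqRHS](size_ape2_hist a0 c p (fun k b => Rw k b w) (fun k b => G k b w)) count_size. Qed.

Lemma initial_pull t w a : (t < #|A|)%N ->
  ape2_action a0 c p (fun k b => Rw k b w) (fun k b => G k b w) t.+1 = a ->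
  pulls (hist t w) a = 0%N.
Proof.
move=> tA; rewrite /ape2_action -/(hist t.+1 w) hist_initial//.
rewrite (take_nth a0) -?cardE// last_rcons hist_initial ?(ltnW tA)// => na.
have : uniq (take t.+1 (enum A)) by rewrite take_uniq// enum_uniq.
by rewrite (take_nth a0) -?cardE// rcons_uniq na => /andP[/count_memPn ].
Qed.

End pulls_history.

(** * Expected pulls and regret of one suboptimal arm *)

Section suboptimal_arm.
Context (R : realType) (c p nu : R) (F : R -> R) (A : finType) (a0 : A).
Context (d : measure_display) (Omega : measurableType d) (P : probability Omega R).
Variables (Rw G : nat -> A -> Omega -> R) (r : A -> R).
Hypotheses (c0 : 0 < c) (p12 : 1 < p <= 2) (PF : perturbation_assumption F).
Hypothesis mRw : forall t a, (0 < t)%N -> measurable_fun setT (Rw t a).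
Hypothesis mG : forall t a, (0 < t)%N -> measurable_fun setT (G t a).
Hypothesis ERw : forall t a, (0 < t)%N ->
  (\int[P]_w (Rw t a w)%:E = (r a)%:E)%E.
Hypothesis Epow : forall t a, (0 < t)%N ->
  (\int[P]_w (`|Rw t a w| `^ p)%:E <= nu%:E)%E.
Hypothesis Gcdf : forall t a g, (0 < t)%N ->
  P [set w | G t a w < g] = (F g)%:E.
Hypothesis ind : mutually_independent P
  (fun i : (nat * A) + (nat * A) =>
     match i with inl (t, _) | inr (t, _) => (0 < t)%N end)
  (fun i => match i with
            | inl (t, a) => Rw t a
            | inr (t, a) => G t a end).

Notation H := (hist c p a0 Rw G).
Notation act := (act c p a0 Rw G).
Notation est := (arm_est c p a0 Rw G).
Notation scale := (scale c p).
Notation arm_index := (arm_index c p a0 Rw G).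
Let M := b_p p * `|nu| / c `^ p.

Lemma pr_split_pulls t b (Q : Omega -> bool) m N : measurable_fun setT Q ->
  (forall w, Q w -> (m <= pulls (H t w) b < N)%N) ->
  pr P [set w | Q w] <=
  \sum_(m <= n < N) pr P [set w | Q w && (pulls (H t w) b == n)].
Proof.
move=> mQ QN.
have mk (S : pred nat) : measurable_fun setT (fun w => Q w && S (pulls (H t w) b)).
  apply: measurable_and => //.
  exact: (measurable_hist_pred c p a0 mRw mG t (fun h => S (pulls h b))).
have [mN|Nm] := leqP m N; last first.
  rewrite big_geq ?(ltnW Nm)//.
  suff -> : [set w | Q w] = set0 by rewrite /pr measure0.
  apply/seteqP; split => // w /= /QN /andP[h1 h2].
  by move: (leq_ltn_trans h1 (ltn_trans h2 Nm)); rewrite ltnn.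
suff : pr P [set w | Q w && (m <= pulls (H t w) b < N)%N] <=
  \sum_(m <= n < N) pr P [set w | Q w && (pulls (H t w) b == n)].
  apply: le_trans; apply: pr_le.
  - exact: measurable_bool_set.
  - exact: measurable_bool_set (mk (fun n => m <= n < N)%N).
  - by move=> w /= Qw; rewrite Qw QN.
clear QN; rewrite -(subnKC mN); elim: (N - m)%N => [|k IH].
  rewrite addn0 big_geq//; suff -> : [set w | Q w && (m <= pulls (H t w) b < m)%N] = set0.
    by rewrite /pr measure0.
  apply/seteqP; split => // w /= /andP[_ /andP[h1 h2]].
  by move: (leq_trans h2 h1); rewrite ltnn.
rewrite addnS big_nat_recr ?leq_addr//=.
apply: le_trans (lerD IH (lexx _)); apply: pr_setU_le.
- exact: measurable_bool_set (mk (fun n => m <= n < (m + k).+1)%N).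
- exact: measurable_bool_set (mk (fun n => m <= n < m + k)%N).
- exact: measurable_bool_set (mk (fun n => n == m + k)%N).
move=> w /= /andP[-> /andP[-> h]] /=; rewrite ltnS leq_eqVlt in h.
by case/orP: h => h; [right|left].
Qed.

Variables (a astar : A).
Hypothesis gap : r a < r astar.

Let Delta := r astar - r a.
Let y := r astar - Delta / 3.
Let D (n : nat) := Delta / 3 / scale n.

Let mact t b : measurable_fun setT (fun w => act t.+1 w == b).
Proof. exact: measurable_act_eq. Qed.

Let mest t b : measurable_fun setT (est b t).
Proof. exact: measurable_arm_est. Qed.

(** The thresholds are left free so that quantiles enter only afterwards: [N2] pulls of [a] make the
    scaled gap exceed [g2], and [N1] pulls of [astar] make [F (- D_n / 2)] at most [y1]. *)
Lemma suboptimal_pulls_le (CW g2 y1 y2 : R) (N1 N2 T : nat) : 0 <= CW ->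
  (forall N : nat,
    \sum_(k < N) expR (- k%:R) * (odds F k.+1%:R - odds F k%:R) <= CW) ->
  (forall n, (0 < n)%N -> (N1 <= n)%N -> F (- D n / 2) <= y1) ->
  (forall n, (0 < n)%N -> (N2 <= n)%N -> g2 <= D n) -> 1 - F g2 <= y2 ->
  0 <= y1 ->
  \sum_(0 <= t < T) pr P [set w | act t.+1 w == a] <=
  1 + N2%:R + N1%:R + T%:R * y2 + T%:R * (2 * y1) +
  (3 + CW) * expR M * \sum_(1 <= n < T) expR (- (D n / 2)).
Proof.
move=> CW0 HCW HN1 HN2 Fg2 y10.
have Delta0 : 0 < Delta by rewrite subr_gt0.
have sc n : (0 < n)%N -> 0 < scale n by exact: scale_gt0.
have D0 n : (0 < n)%N -> 0 < D n by move=> /sc ?; rewrite divr_gt0// divr_gt0.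
pose B1 t w := (act t.+1 w == a) && (pulls (H t w) a < N2)%N.
(* [B2] and [B4] do not mention the action: [B2] is paid round by round, while [B4] is charged to
   pulls of [astar]. *)
pose B2 t w := g2 <= G t.+1 a w.
pose B3 t w := (act t.+1 w == a) && (Delta / 3 <= est a t w - r a).
pose B4 t w := [forall b, arm_index b t w <= y].
have mB1 t : measurable_fun setT (B1 t).
  apply: measurable_and => //.
  exact: (measurable_hist_pred c p a0 mRw mG t (fun h => (pulls h a < N2)%N)).
have mB2 t : measurable_fun setT (B2 t).
  by apply: measurable_fun_ler => //; exact: mG.
have mB3 t : measurable_fun setT (B3 t).
  apply: measurable_and => //; apply: measurable_fun_ler => //.
  exact: measurable_funB.
have mB4 t : measurable_fun setT (B4 t).
  have -> : B4 t = (fun w => \big[andb/true]_(b : A) (arm_index b t w <= y)).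
    by apply/funext => w; rewrite big_andE.
  elim: (index_enum A) => [|b s IH].
    by under eq_fun do rewrite big_nil; exact: measurable_cst.
  under eq_fun do rewrite big_cons.
  apply: measurable_and => //; apply: measurable_fun_ler => //.
  exact: measurable_arm_index.
(* In the round-robin phase the chosen arm has no earlier pull, so [sum_pr_pull] with [n = 0] covers
   the whole phase. *)
have initial : \sum_(0 <= t < T | (t < #|A|)%N) pr P [set w | act t.+1 w == a] <= 1.
  apply: le_trans (sum_pr_pull c p a0 mRw mG ind a 0 T).
  rewrite big_mkcond/=; apply: ler_sum => t _.
  case: ifP => [tA|_]; last exact: pr_ge0.
  apply: pr_le; [exact: measurable_bool_set| |].
    apply: measurable_bool_set; apply: measurable_and => //.
    exact: (measurable_hist_pred c p a0 mRw mG t (fun h => pulls h a == 0%N)).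
  move=> w /= /eqP actE; rewrite actE eqxx andbT.
  by apply/eqP; exact: (initial_pull tA actE).
have later t : (#|A| <= t)%N -> pr P [set w | act t.+1 w == a] <=
    pr P [set w | B1 t w] + (pr P [set w | B2 t w] +
    (pr P [set w | B3 t w] + pr P [set w | B4 t w])).
  move=> At.
  have mU34 := measurable_or (mB3 t) (mB4 t).
  have mU234 := measurable_or (mB2 t) mU34.
  apply: (@le_trans _ _ (pr P [set w | B1 t w] +
      pr P [set w | B2 t w || (B3 t w || B4 t w)])).
    apply: pr_setU_le; try exact: measurable_bool_set.
    move=> w /= acta.
    have [B1w|B1w] := boolP (B1 t w); [by left|right].
    have [B3w|B3w] := boolP (B3 t w); first by rewrite orbT.
    have [B4w|B4w] := boolP (B4 t w); first by rewrite !orbT.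
    (* Some index exceeds [y = r_a + 2 Delta / 3], hence so does that of the pulled arm [a]. Its
       estimate is below [r_a + Delta / 3], so the perturbation term exceeds [Delta / 3], which
       forces [G > D_n >= g2]. *)
    rewrite !orbF; move: B1w B3w; rewrite /B1 /B3 acta/= -leqNgt -ltNge => N2n hest.
    have n0 := @pulls_gt0 R c p A a0 Omega Rw G t w a At.
    have [b] := existsP B4w.
    rewrite -ltNge => yb; have := act_max c p a0 Rw G b w At.
    rewrite (eqP acta) => /(lt_le_trans yb); rewrite /arm_index.
    have := HN2 _ n0 N2n; rewrite /D /B2 => h1 h2; apply: le_trans h1 _.
    rewrite ler_pdivrMr ?sc//; rewrite mulrC; apply: ltW.
    by move: h2 hest; rewrite /y /Delta; lra.
  rewrite lerD2l.
  apply: (@le_trans _ _ (pr P [set w | B2 t w] + pr P [set w | B3 t w || B4 t w])).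
    apply: pr_setU_le; try exact: measurable_bool_set.
    by move=> w /= /orP[]; [left|right].
  rewrite lerD2l; apply: pr_setU_le; try exact: measurable_bool_set.
  by move=> w /= /orP[]; [left|right].
have b1 : \sum_(0 <= t < T) pr P [set w | B1 t w] <= N2%:R.
  apply: (@le_trans _ _ (\sum_(0 <= t < T) \sum_(0 <= n < N2)
      pr P [set w | B1 t w && (pulls (H t w) a == n)])).
    apply: ler_sum => t _; apply: pr_split_pulls => // w /andP[_ ->].
    by [].
  rewrite exchange_big/=.
  apply: (@le_trans _ _ (\sum_(0 <= n < N2) 1)); last first.
    by rewrite sumr_const_nat subn0.
  apply: ler_sum => n _.
  apply: le_trans (sum_pr_pull c p a0 mRw mG ind a n T).
  apply: ler_sum => t _; apply: pr_le.
  - apply: measurable_bool_set; apply: measurable_and => //.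
    exact: (measurable_hist_pred c p a0 mRw mG t (fun h => pulls h a == n)).
  - apply: measurable_bool_set; apply: measurable_and => //.
    exact: (measurable_hist_pred c p a0 mRw mG t (fun h => pulls h a == n)).
  - by move=> w /= /andP[/andP[-> _] ->].
have b2 : \sum_(0 <= t < T) pr P [set w | B2 t w] <= T%:R * y2.
  apply: (@le_trans _ _ (\sum_(0 <= t < T) y2)); last first.
    by rewrite sumr_const_nat subn0 mulr_natl.
  apply: ler_sum => t _; apply: le_trans Fg2.
  have mlt : measurable_fun setT (fun w => G t.+1 a w < g2).
    by apply: measurable_fun_ltr => //; exact: mG.
  have -> : [set w | B2 t w] = ~` [set w | G t.+1 a w < g2].
    by apply/seteqP; split => w /=; rewrite /B2 leNgt => /negP.
  rewrite /pr probability_setC; last exact: measurable_bool_set.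
  by rewrite Gcdf.
set S := \sum_(1 <= n < T) expR (- (D n / 2)).
have b3 : \sum_(0 <= t < T | (#|A| <= t)%N) pr P [set w | B3 t w] <= expR M * S.
  pose dev t n w := ((pulls (H t w) a == n) && (act t.+1 w == a)) &&
                (D n <= 1 * (est a t w - r a) / scale n).
  apply: (@le_trans _ _ (\sum_(0 <= t < T) \sum_(1 <= n < T)
      pr P [set w | dev t n w])).
    rewrite big_mkcond/= big_seq [leRHS]big_seq; apply: ler_sum => t.
    rewrite mem_index_iota => /andP[_ tT].
    case: ifP => [At|_]; last by apply: sumr_ge0 => n _; exact: pr_ge0.
    apply: (@le_trans _ _ (\sum_(1 <= n < T)
      pr P [set w | B3 t w && (pulls (H t w) a == n)])).
      apply: pr_split_pulls => // w _.
      rewrite (@pulls_gt0 R c p A a0 Omega Rw G t w a At)/=.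
      exact: leq_ltn_trans (pulls_le_round c p a0 Rw G t w a) tT.
    rewrite big_seq [leRHS]big_seq; apply: ler_sum => n.
    rewrite mem_index_iota => /andP[n0 _]; apply: pr_le.
    - apply: measurable_bool_set; apply: measurable_and => //.
      exact: (measurable_hist_pred c p a0 mRw mG t (fun h => pulls h a == n)).
    - apply: measurable_bool_set; apply: measurable_and.
        apply: measurable_and => //.
        exact: (measurable_hist_pred c p a0 mRw mG t (fun h => pulls h a == n)).
      apply: measurable_fun_ler => //; apply: measurable_funM => //.
      by apply: measurable_funM => //; exact: measurable_funB.
    - move=> w /= /andP[/andP[acta hest] nw]; rewrite /dev nw acta /= mul1r /D.
      by apply: ler_wpM2r => //; rewrite invr_ge0 ltW// sc.
  rewrite exchange_big/= /S mulr_sumr big_seq [leRHS]big_seq; apply: ler_sum => n.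
  rewrite mem_index_iota => /andP[n0 _].
  have := sum_deviation_le a0 c0 p12 mRw mG ERw Epow ind a (D n) (or_introl erefl) n0 T.
  move/le_trans; apply; rewrite -/M -expRD ler_expR.
  by have := D0 _ n0; lra.
have b4 : \sum_(0 <= t < T | (#|A| <= t)%N) pr P [set w | B4 t w] <=
    N1%:R + T%:R * (2 * y1) + (2 + CW) * expR M * S.
  have Dstar n : (r astar - y) / scale n = D n by rewrite /D /y; congr (_ / _); ring.
  have ygap : y < r astar by rewrite /y; have := Delta0; lra.
  pose lost t n w := ([forall (b | b != astar), arm_index b t w <= y] &&
      (pulls (H t w) astar == n)) &&
      (G t.+1 astar w <= (y - est astar t w) / scale n).
  apply: (@le_trans _ _ (\sum_(0 <= t < T | (#|A| <= t)%N) \sum_(1 <= n < T)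
      pr P [set w | lost t n w])).
    rewrite big_seq_cond [leRHS]big_seq_cond; apply: ler_sum => t.
    rewrite mem_index_iota => /andP[/andP[_ tT] At].
    apply: (@le_trans _ _ (\sum_(1 <= n < T)
      pr P [set w | B4 t w && (pulls (H t w) astar == n)])).
      apply: pr_split_pulls => // w _.
      rewrite (@pulls_gt0 R c p A a0 Omega Rw G t w astar At)/=.
      exact: leq_ltn_trans (pulls_le_round c p a0 Rw G t w astar) tT.
    rewrite big_seq [leRHS]big_seq; apply: ler_sum => n.
    rewrite mem_index_iota => /andP[n0 _]; apply: pr_le.
    - apply: measurable_bool_set; apply: measurable_and => //.
      exact: (measurable_hist_pred c p a0 mRw mG t (fun h => pulls h astar == n)).
    - apply: measurable_bool_set; apply: measurable_and.
        apply: measurable_and.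
          apply: (measurable_of_before_perturbation mRw mG).
          exact: (@others_before_perturbation R c p A a0 d Omega Rw G astar y t).
        exact: (measurable_hist_pred c p a0 mRw mG t (fun h => pulls h astar == n)).
      apply: measurable_fun_ler; first exact: mG.
      by apply: measurable_funM => //; exact: measurable_funB.
    - move=> w /= /andP[B4w nw]; rewrite /lost nw andbT.
      apply/andP; split; first by apply/forallP => b; apply/implyP => _; exact: (forallP B4w).
      have := forallP B4w astar; rewrite /arm_index (eqP nw) ler_pdivlMr ?sc//.
      by rewrite mulrC; lra.
  rewrite exchange_big/=.
  apply: (@le_trans _ _ (\sum_(1 <= n < T)
      (odds F (- D n / 2) + (2 + CW) * expR M * expR (- (D n / 2))))).
    rewrite big_seq [leRHS]big_seq; apply: ler_sum => n.
    rewrite mem_index_iota => /andP[n0 _].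
    have := sum_pr_lost_rounds_le a0 c0 p12 PF mRw mG ERw Epow Gcdf ind n0 ygap T CW0 HCW.
    by rewrite Dstar -/M -mulrA -expRD.
  rewrite big_split/= -mulr_sumr lerD2r.
  (* The odds at a negative point are at most 1, which serves for [n < N1], and at most [2 F], which
     serves beyond. *)
  apply: (@le_trans _ _ (\sum_(1 <= n < T) ((n < N1)%:R + 2 * y1))).
    rewrite big_seq [leRHS]big_seq; apply: ler_sum => n.
    rewrite mem_index_iota => /andP[n0 _].
    have Dn := D0 _ n0; have mDn : - D n / 2 <= 0 by lra.
    have [nN1|N1n] := ltnP n N1.
      apply: (@le_trans _ _ 1); last by rewrite lerDl mulr_ge0.
      apply: le_trans (odds0_le1 PF); exact: (odds_le PF).
    rewrite add0r; apply: le_trans (odds_le_double PF mDn) _.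
    by rewrite ler_pM2l//; exact: HN1.
  rewrite big_split/=; apply: lerD.
    exact: sum_ltn_le.
  rewrite sumr_const_nat -[leLHS]mulr_natl; apply: ler_wpM2r; first by rewrite mulr_ge0.
  by rewrite ler_nat leq_subr.
have S0 : 0 <= S by apply: sumr_ge0 => n _; exact: expR_ge0.
rewrite (bigID (fun t => (t < #|A|)%N))/=.
apply: (@le_trans _ _ (1 + \sum_(0 <= t < T | (#|A| <= t)%N) (pr P [set w | B1 t w] + (pr P [set w | B2 t w] +
    (pr P [set w | B3 t w] + pr P [set w | B4 t w]))))).
  apply: lerD => //; rewrite (eq_bigl (fun t => #|A| <= t)%N); last first.
    by move=> t; rewrite -leqNgt.
  by apply: ler_sum => t; exact: later.
rewrite !big_split/=.
have drop (f : nat -> R) : (forall t, 0 <= f t) ->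
    \sum_(0 <= t < T | (#|A| <= t)%N) f t <= \sum_(0 <= t < T) f t.
  move=> f0; rewrite [leLHS]big_mkcond/=; apply: ler_sum => t _.
  by case: ifP.
have d1 := drop _ (fun t => pr_ge0 P [set w | B1 t w]).
have d2 := drop _ (fun t => pr_ge0 P [set w | B2 t w]).
have -> : (3 + CW) * expR M * S = expR M * S + (2 + CW) * expR M * S by ring.
lra.
Qed.

Let q := p / (p - 1).
(** Chosen so that [T] rounds of this probability, each costing [Delta], contribute
    [c^q / Delta^(1/(p-1))]. *)
Let level_mass (T : nat) := c `^ q / (T%:R * Delta `^ q).
(** The 3 pays for [T y2 + 2 T y1] with [y1 = y2 = level_mass T]; the rest pays for the exponential
    series, of length scale [(6 c / Delta)^q]. *)
Let constant (CW : R) := 3 * c `^ q +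
  (3 + CW) * expR M * ((1 + (2 * q) `^ q) ^+ 2 * (6 * c) `^ q).

Lemma suboptimal_regret_le (CW : R) (T : nat) : 0 <= CW ->
  (forall N : nat,
    \sum_(k < N) expR (- k%:R) * (odds F k.+1%:R - odds F k%:R) <= CW) ->
  Delta * \sum_(0 <= t < T) pr P [set w | act t.+1 w == a] <=
  3 * (constant CW / Delta `^ (p - 1)^-1
       + (6 * c) `^ q / Delta `^ (p - 1)^-1
           * posp (- Finv0 F (level_mass T)) `^ q
       + (3 * c) `^ q / Delta `^ (p - 1)^-1
           * posp (Finv0 F (1 - level_mass T)) `^ q
       + Delta).
Proof.
move=> CW0 HCW; set C := constant CW; set v := level_mass T.
have Delta0 : 0 < Delta by rewrite subr_gt0.
have /andP[p1 p2] := p12.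
have q0 : 0 < q by rewrite divr_gt0; lra.
pose W := Delta `^ (p - 1)^-1.
have W0 : 0 < W by exact: powR_gt0.
have DqE : Delta `^ q = Delta * W.
  rewrite /W -[X in X * _]powRr1 ?(ltW Delta0)// -powRD_gt0//.
  by congr (_ `^ _); rewrite /q; field; lra.
have cq0 : 0 < c `^ q by exact: powR_gt0.
have c6q0 : 0 < (6 * c) `^ q by rewrite powR_gt0// mulr_gt0.
have c3q0 : 0 < (3 * c) `^ q by rewrite powR_gt0// mulr_gt0.
pose K := (1 + (2 * q) `^ q) ^+ 2.
have K0 : 0 <= K by exact: sqr_ge0.
pose Z := (3 + CW) * expR M * (K * (6 * c) `^ q).
have CW30 : 0 <= 3 + CW by rewrite addr_ge0.
have Z0 : 0 <= Z.
  by apply: mulr_ge0; apply: mulr_ge0; rewrite ?expR_ge0 ?powR_ge0.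
have CE : C = 3 * c `^ q + Z by [].
rewrite -/W; set X1 := (6 * c) `^ q / W * _; set X2 := (3 * c) `^ q / W * _.
have X10 : 0 <= X1.
  by apply: mulr_ge0; [apply: divr_ge0; exact: ltW|exact: powR_ge0].
have X20 : 0 <= X2.
  by apply: mulr_ge0; [apply: divr_ge0; exact: ltW|exact: powR_ge0].
have cW0 : 0 <= c `^ q / W by apply: divr_ge0; exact: ltW.
have ZW0 : 0 <= Z / W by apply: divr_ge0 => //; exact: ltW.
have CWE : C / W = 3 * (c `^ q / W) + Z / W by rewrite CE; ring.
have gapE k n : 0 < k ->
    (n%:R / (k * c / Delta) `^ q) `^ q^-1 = Delta / k / scale n.
  move=> k0; have kc : 0 < k * c by rewrite mulr_gt0.
  rewrite powR_quotient_root//; last by rewrite divr_gt0.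
  (* At [n = 0] both sides vanish: [scale 0] is a division by zero. *)
  rewrite /scale; case: n => [|n].
    have [->|pn] := eqVneq (1 - p^-1) 0; first by rewrite !powRr0; field; rewrite !gt_eqF.
    by rewrite powR0// invr0 mulr0 invr0 mulr0 mul0r.
  have : 0 < n.+1%:R `^ (1 - p^-1) :> R by rewrite powR_gt0// ltr0n.
  by move: (_ `^ _) => x x0; field; rewrite !gt_eqF.
have n0E k : 0 < k -> Delta * (k * c / Delta) `^ q = (k * c) `^ q / W.
  move=> k0; rewrite powRM ?invr_ge0 ?(ltW Delta0)//; last by rewrite mulr_ge0// ltW.
  rewrite -powR_inv1 ?(ltW Delta0)// powRAC powR_inv1 ?powR_ge0// DqE.
  by field; rewrite !gt_eqF.
have [T0|Tn0] := posnP T.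
  rewrite T0 big_geq// mulr0; apply: mulr_ge0 => //.
  by rewrite CWE; lra.
have T0 : 0 < T%:R :> R by rewrite ltr0n.
have v0 : 0 < v by rewrite /v /level_mass divr_gt0// mulr_gt0// powR_gt0.
have TvE : Delta * (T%:R * v) = c `^ q / W.
  by rewrite /v /level_mass DqE; field; rewrite !gt_eqF.
(* The quantiles are undefined here, but then [T Delta <= T Delta v = c^q / W], and counting every
   round suffices. *)
have [v1|v1] := leP 1 v.
  apply: (@le_trans _ _ (Delta * (T%:R * v))); last by rewrite TvE CWE; lra.
  apply: ler_wpM2l; first exact: ltW.
  apply: (@le_trans _ _ (\sum_(0 <= t < T) 1)).
    by apply: ler_sum => t _; apply: pr_le1; exact: measurable_bool_set.
  by rewrite sumr_const_nat subn0 -[leLHS]mulr1; apply: ler_wpM2l => //; exact: ltW.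
have v01 : 0 < v < 1 by rewrite v0 v1.
have v01' : 0 < 1 - v < 1 by lra.
pose L1 := (6 * c / Delta) `^ q * posp (- Finv F v) `^ q.
pose L2 := (3 * c / Delta) `^ q * posp (Finv F (1 - v)) `^ q.
have L10 : 0 <= L1 by rewrite mulr_ge0 ?powR_ge0.
have L20 : 0 <= L2 by rewrite mulr_ge0 ?powR_ge0.
(* [L1] and [L2] solve [D_n / 2 = posp (- Finv F v)] and [D_n = posp (Finv F (1 - v))] for [n];
   rounding each up costs one more [Delta]. *)
have [N1 /andP[N1l N1u]] := natr_ge_ceil L10.
have [N2 /andP[N2l N2u]] := natr_ge_ceil L20.
have posp_ge0 (x : R) : 0 <= posp x by rewrite /posp le_max lexx orbT.
have posp_ge (x : R) : x <= posp x by rewrite /posp le_max lexx.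
have levelE k x n : 0 < k -> (k * c / Delta) `^ q * posp x `^ q <= n%:R ->
    x <= Delta / k / scale n.
  move=> k0 h; apply: le_trans (posp_ge x) _; rewrite -gapE//.
  have kq : 0 < (k * c / Delta) `^ q by rewrite powR_gt0// divr_gt0// mulr_gt0.
  have -> : posp x = (posp x `^ q) `^ q^-1.
    by rewrite -powRrM mulfV ?gt_eqF// powRr1.
  apply: ge0_ler_powR; rewrite ?nnegrE ?powR_ge0 ?invr_ge0 ?(ltW q0)//.
    by rewrite divr_ge0// ltW.
  by rewrite ler_pdivlMr// mulrC.
have D2 n : D n / 2 = Delta / 6 / scale n by rewrite /D; lra.
have H1 n : (0 < n)%N -> (N1 <= n)%N -> F (- D n / 2) <= v.
  move=> n0 N1n; apply: (cdf_Finv_le PF v01).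
  have := @levelE 6 (- Finv F v) n ltac:(lra) _; rewrite -D2 => h.
  have : - Finv F v <= D n / 2.
    by apply: h; apply: le_trans N1l _; rewrite ler_nat.
  lra.
have H2 n : (0 < n)%N -> (N2 <= n)%N -> Finv F (1 - v) <= D n.
  move=> n0 N2n; apply: levelE; first by lra.
  by apply: le_trans N2l _; rewrite ler_nat.
have F2 : 1 - F (Finv F (1 - v)) <= v.
  have := cdf_Finv_ge PF v01' (lexx _); lra.
have := suboptimal_pulls_le T CW0 HCW H1 H2 F2 (ltW v0).
move=> /(ler_wpM2l (ltW Delta0))/le_trans; apply.
have sumE : \sum_(1 <= n < T) expR (- (D n / 2)) <= K * (6 * c / Delta) `^ q.
  under eq_bigr do rewrite D2 -gapE//.
  by apply: sum_exp_root_le => //; rewrite powR_gt0// divr_gt0// mulr_gt0.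
have G3 : 0 <= (3 + CW) * expR M by rewrite mulr_ge0 ?expR_ge0.
have s1 : Delta * ((3 + CW) * expR M * \sum_(1 <= n < T) expR (- (D n / 2))) <= Z / W.
  apply: (@le_trans _ _ (Delta * ((3 + CW) * expR M * (K * (6 * c / Delta) `^ q)))).
    by apply: ler_wpM2l; [exact: ltW|exact: ler_wpM2l].
  have -> : Delta * ((3 + CW) * expR M * (K * (6 * c / Delta) `^ q)) =
      (3 + CW) * expR M * K * (Delta * (6 * c / Delta) `^ q) by ring.
  by rewrite n0E// /Z !mulrA.
have s2 : Delta * N1%:R <= X1 + Delta.
  apply: (@le_trans _ _ (Delta * (L1 + 1))).
    by apply: ler_wpM2l => //; exact: ltW.
  by rewrite mulrDr mulr1 /L1 mulrA n0E// /X1 /Finv0 v01.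
have s3 : Delta * N2%:R <= X2 + Delta.
  apply: (@le_trans _ _ (Delta * (L2 + 1))).
    by apply: ler_wpM2l => //; exact: ltW.
  by rewrite mulrDr mulr1 /L2 mulrA n0E// /X2 /Finv0 v01'.
have s4 : Delta * (T%:R * v) = c `^ q / W := TvE.
rewrite !(mulrDr Delta) mulr1 s4.
have -> : Delta * (T%:R * (2 * v)) = 2 * (c `^ q / W) by rewrite -s4; ring.
rewrite CWE; lra.
Qed.

End suboptimal_arm.

Theorem theorem3 (R : realType) :
  (* absolute hidden constant C0 *)
  exists C0 : R, 0 < C0 /\
  forall (c p nu : R) (F : R -> R),
    0 < c -> 1 < p <= 2 -> perturbation_assumption F ->
    (* constant C_{c,p,nu_p,F} *)
    exists C : R, 0 < C /\
    forall (A : finType) (a0 : A) (d : measure_display) (Omega : measurableType d)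
      (P : probability Omega R) (Rw G : nat -> A -> Omega -> R)
      (r : A -> R) (astar : A) (T : nat),
      (* mean rewards in [0,1], unique optimal arm *)
      (forall a, 0 <= r a <= 1) ->
      (forall a, a != astar -> r a < r astar) ->
      (* measurability of rewards and perturbations *)
      (forall t a, (0 < t)%N -> measurable_fun setT (Rw t a)) ->
      (forall t a, (0 < t)%N -> measurable_fun setT (G t a)) ->
      (* E[R_{t,a}] = r_a (zero-mean noise) and E|R_{t,a}|^p <= nu *)
      (forall t a, (0 < t)%N -> (\int[P]_w (Rw t a w)%:E = (r a)%:E)%E) ->
      (forall t a, (0 < t)%N -> (\int[P]_w (`|Rw t a w| `^ p)%:E <= nu%:E)%E) ->
      (* noise i.i.d. over t *)
      (forall t s a (B : set R), (0 < t)%N -> (0 < s)%N -> measurable B ->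
         P (Rw t a @^-1` B) = P (Rw s a @^-1` B)) ->
      (* perturbations have CDF F *)
      (forall t a g, (0 < t)%N -> P [set w | G t a w < g] = (F g)%:E) ->
      (* all rewards and perturbations (rounds t >= 1) mutually independent *)
      mutually_independent P
        (fun i : (nat * A) + (nat * A) =>
           match i with inl (t, _) | inr (t, _) => (0 < t)%N end)
        (fun i => match i with
                  | inl (t, a) => Rw t a
                  | inr (t, a) => G t a end) ->
      let q := p / (p - 1) in
      let Delta := fun a => r astar - r a in
      let y := fun a => c `^ q / (T%:R * Delta a `^ q) in
      (\int[P]_w (\sum_(1 <= t < T.+1)
           (r astar - r (ape2_action a0 c p (fun k b => Rw k b w)
                                      (fun k b => G k b w) t)))%:E
       <= (C0 * \sum_(a | a != astar)
             (C / Delta a `^ (p - 1)^-1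
              + (6 * c) `^ q / Delta a `^ (p - 1)^-1
                  * posp (- Finv0 F (y a)) `^ q
              + (3 * c) `^ q / Delta a `^ (p - 1)^-1
                  * posp (Finv0 F (1 - y a)) `^ q
              + Delta a))%:E)%E.
Proof.
(* The 3 accommodates three copies of [Delta]: one initial pull and two roundings. *)
exists 3; split => // c p nu F c0 p12 PF.
have [CW [CW0 HCW]] := odds_weighted_increments PF.
pose q := p / (p - 1).
exists (3 * c `^ q + (3 + CW) * expR (b_p p * `|nu| / c `^ p) *
  ((1 + (2 * q) `^ q) ^+ 2 * (6 * c) `^ q)); split.
  apply: ltr_pwDl; first by rewrite mulr_gt0// powR_gt0.
  by apply: mulr_ge0; apply: mulr_ge0;
    rewrite ?expR_ge0 ?powR_ge0 ?sqr_ge0// addr_ge0.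
move=> A a0 d Omega P Rw G r astar T _ ropt mRw mG ERw Epow _ Gcdf ind.
cbv zeta; pose Delta b := r astar - r b.
have mact t b : measurable_fun setT (fun w => act c p a0 Rw G t.+1 w == b).
  exact: measurable_act_eq.
pose ind1 t b w : R := if act c p a0 Rw G t.+1 w == b then 1 else 0.
have mind t b : measurable_fun setT (ind1 t b) by exact: measurable_fun_ifT.
have ind0 t b w : 0 <= ind1 t b w by rewrite /ind1; case: ifP.
have D0 b : 0 <= Delta b.
  by rewrite subr_ge0; have [->//|/ropt/ltW] := eqVneq b astar.
pose others := [seq b <- index_enum A | b != astar].
have -> : (\int[P]_w (\sum_(1 <= t < T.+1)
     (r astar - r (ape2_action a0 c p (fun k b => Rw k b w)
                                (fun k b => G k b w) t)))%:E)%E =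
  (\int[P]_w \sum_(b <- others) (Delta b)%:E * (\sum_(0 <= t < T) ind1 t b w)%:E)%E.
  apply: eq_integral => w _; rewrite big_filter; under [RHS]eq_bigr do rewrite -EFinM.
  rewrite !sumEFin; congr EFin; rewrite big_add1/=.
  under [RHS]eq_bigr do rewrite mulr_sumr.
  rewrite exchange_big/=; apply: eq_bigr => t _.
  rewrite -/(act c p a0 Rw G t.+1 w); set b := act _ _ _ _ _ _ _.
  have [bE|bn] := eqVneq b astar.
    rewrite bE subrr big1// => b' b'n; rewrite /ind1 -/b bE eq_sym (negPf b'n).
    by rewrite mulr0.
  rewrite (bigD1 b)//= /ind1 -/b eqxx mulr1 big1 ?addr0// => b' /andP[_ bb'].
  by rewrite eq_sym (negPf bb') mulr0.
have msum b : measurable_fun setT (fun w => (\sum_(0 <= t < T) ind1 t b w)%:E).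
  by apply/measurable_EFinP; exact: measurable_sum.
have sum0 b w : 0 <= \sum_(0 <= t < T) ind1 t b w by exact: sumr_ge0.
rewrite ge0_integral_sum//; last 2 first.
- by move=> b; apply: emeasurable_funM.
- by move=> b w _; rewrite mule_ge0// lee_fin.
rewrite big_filter mulr_sumr -sumEFin; apply: lee_sum => b bn.
rewrite ge0_integralZl//; last 2 first.
- by move=> w _; rewrite lee_fin.
- by rewrite lee_fin.
have -> : (\int[P]_w (\sum_(0 <= t < T) ind1 t b w)%:E =
    (\sum_(0 <= t < T) pr P [set w | act c p a0 Rw G t.+1 w == b])%:E)%E.
  under eq_integral do rewrite -sumEFin.
  rewrite ge0_integral_sum//; last 2 first.
  - by move=> t; exact/measurable_EFinP.
  - by move=> t w _; rewrite lee_fin.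
  by rewrite -sumEFin; apply: eq_bigr => t _; rewrite pr_indicator.
rewrite -EFinM lee_fin.
exact: (suboptimal_regret_le a0 c0 p12 PF mRw mG ERw Epow Gcdf ind (ropt _ bn) T CW0 HCW).
Qed.
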